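(* Let $G$ be a finite simple regular graph with $m$ edges and clique number $\omega$, and suppose $G$ is not the complete graph $K_{\omega}$. Let $\mu_1 \geq \mu_2$ denote the two largest eigenvalues (counted with multiplicity) of the adjacency matrix $A_G$ of $G$. Then $$\mu_1^2 + \mu_2^2 \leq \frac{2(\omega - 1)}{\omega} m.$$ Moreover, equality holds if and only if either (1) $G$ is the Tur\'{a}n graph $T(n, \omega)$ with $n$ divisible by $\omega$, or (2) $G$ is the disjoint union $T(n/2, \omega) \sqcup T(n/2, \omega)$ of two Tur\'{a}n graphs with $n$ divisible by $2\omega$, where $n$ is the number of vertices of $G$.
   Context: The clique number $\omega$ of $G$ is the size of a largest clique in $G$. The Tur\'{a}n graph $T(n, r)$ is the complete $r$-partite graph on $n$ vertices whose part sizes differ by at most one (when $r \mid n$, all parts have size $n/r$). *)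

(* Defs.v *)
From HB Require Import structures.
From mathcomp Require Import all_boot all_order all_algebra.
From mathcomp Require Import reals.
Set Implicit Arguments. Unset Strict Implicit. Unset Printing Implicit Defensive.
Import Order.TTheory GRing.Theory Num.Theory.

Definition simple_graph (n : nat) (e : rel 'I_n) : Prop :=
  symmetric e /\ irreflexive e.

Definition regular (n : nat) (e : rel 'I_n) : Prop :=
  exists k : nat, forall v : 'I_n, #|[set w | e v w]| = k.

Definition num_edges (n : nat) (e : rel 'I_n) : nat :=
  #|[set A : {set 'I_n} | [exists x, exists y, (A == [set x; y]) && e x y]]|.

Definition is_clique (n : nat) (e : rel 'I_n) (S : {set 'I_n}) : bool :=
  [forall x in S, forall y in S, (x != y) ==> e x y].

Definition clique_number (n : nat) (e : rel 'I_n) : nat :=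
  \max_(S : {set 'I_n} | is_clique e S) #|S|.

Definition adjmx (R : nzRingType) (n : nat) (e : rel 'I_n) : 'M[R]_n :=
  \matrix_(i, j) ((e i j)%:R)%R.

Definition isomorphic (V W : finType) (e : rel V) (e' : rel W) : Prop :=
  exists f : V -> W, bijective f /\ forall x y, e x y = e' (f x) (f y).

Definition complete_rel (k : nat) : rel 'I_k := fun i j => i != j.

(* Turan graph T(n, r): vertex i is in part (i mod r); parts have sizes
   differing by at most one; two vertices adjacent iff in different parts. *)
Definition turan_rel (n r : nat) : rel 'I_n := fun i j => (i %% r) != (j %% r).

Definition union_rel (a b : nat) (e1 : rel 'I_a) (e2 : rel 'I_b) : rel 'I_(a + b) :=
  fun i j => match split i, split j with
             | inl x, inl y => e1 x y
             | inr x, inr y => e2 x y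
             | _, _ => false
             end.

Arguments complete_rel k : clear implicits.
Arguments turan_rel n r : clear implicits.

(* Main.v *)
(* Let G be d-regular with second eigenvalue lam, and c = 1 - 1/omega; the claim
   is d^2 + lam^2 <= c n d. Non-completeness gives lam >= 0. If lam = 0, this is
   Turan's bound for regular graphs (count edges into a maximum clique), and if
   lam = d it is the sum of Turan's bounds for {v > 0} and its complement, v
   being an eigenvector for lam orthogonal to the constants.

   For 0 < lam < d the inequality is strict. Put rho = lam / d and suppose the
   claim fails or is an equality; then the Motzkin-Straus inequality bounds the
   normalised adjacency form B(f, f) by (1 + rho^2) (mean f)^2 for all f >= 0.
   Test it on the positive and negative parts p, q of v and on the functions
   max(0, dq + v) and max(0, dp - v), where the level dp balances
   sum (p - dp)_+ = n b dp with b = rho (1 - rho) / (1 + rho^2), likewise dq.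
   Splitting p and q at these levels, the resulting inequalities are linear in
   D = n (dp^2 + dq^2) and in the squared norms of the parts of p and q above
   and below the levels, and they are incompatible. *)
Require Import Defs.
From HB Require Import structures.
From mathcomp Require Import all_boot all_order all_algebra.
From mathcomp Require Import reals ring lra zify.
Set Implicit Arguments. Unset Strict Implicit. Unset Printing Implicit Defensive.
Import Order.TTheory GRing.Theory Num.Theory.
Local Open Scope ring_scope.

(** * Balancing levels and the final system of inequalities *)

(** The sum of positive parts is the maximum over [T] of [\sum_(i in T) (s i - del)]. For a fixed
    [T] the equation is linear with solution [F T], and the largest [F T] is the required level. *)
Lemma threshold_exists (R : realFieldType) (I : finType) (s : I -> R) (c : R) :
  0 < c -> (forall i, 0 <= s i) ->
  exists2 del : R, 0 <= del & \sum_i Num.max 0 (s i - del) = c * del.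
Proof.
move=> c0 s0.
pose F (T : {set I}) := (\sum_(i in T) s i) / (c + #|T|%:R).
have cT (T : {set I}) : 0 < c + #|T|%:R by rewrite ltr_wpDr.
pose T0 := [arg max_(T > (set0 : {set I})) F T]%O.
have FT0 (T : {set I}) : F T <= F T0.
  by rewrite /T0; case: Order.TotalTheory.arg_maxP => // T1 _ /(_ T isT).
have sumT (T : {set I}) del : \sum_(i in T) (s i - del)
   = (\sum_(i in T) s i) - #|T|%:R * del.
  by rewrite big_split /= sumrN sumr_const mulr_natl.
exists (F T0); first by rewrite divr_ge0 ?sumr_ge0 // ltW.
set del := F T0.
(* [T1] attains the sum of positive parts: comparing [F T1] with [F T0] gives one inequality,
   keeping only the terms in [T0] gives the other. *)
pose T1 := [set i | 0 <= s i - del].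
have E1 : \sum_i Num.max 0 (s i - del) = \sum_(i in T1) (s i - del).
  rewrite (bigID (mem T1)) /= [X in _ + X]big1 ?addr0; last first.
    by move=> i; rewrite inE -ltNge => /ltW h; apply/max_idPl.
  by apply: eq_bigr => i; rewrite inE => h; apply/max_idPr.
apply/eqP; rewrite eq_le; apply/andP; split.
  rewrite E1 sumT lerBlDr -mulrDl mulrC -ler_pdivrMr //; exact: FT0.
have -> : c * del = \sum_(i in T0) (s i - del).
  have : del * (c + #|T0|%:R) = \sum_(i in T0) s i.
    by rewrite /del /F divfK // gt_eqF.
  by rewrite sumT => <-; ring.
rewrite [X in _ <= X](bigID (mem T0)) /= -[X in X <= _]addr0.
apply: lerD; first by apply: ler_sum => i _; rewrite le_max lexx orbT.
by apply: sumr_ge0 => i _; rewrite le_max lexx.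
Qed.

(** Eliminating [H] between the last two hypotheses leaves a nonnegative coefficient at [M]. The
    bound on [M] then applies, and a negative multiple of [D] would have to be nonnegative. *)
Lemma spectral_gap_numeric (R : realFieldType) (rho b H M D : R) :
  0 < rho < 1 -> (1 + rho ^+ 2) * b = rho * (1 - rho) -> 0 < D ->
  (1 + rho ^+ 2) * M <= rho ^+ 2 * D ->
  2 * rho * (H + 2 * b * D + M) * (1 - rho) <=
    (1 + rho ^+ 2) * ((2 - rho) * 2 * b ^+ 2 * D + (1 - rho) * (2 - rho) * M) ->
  2 * (1 - rho) * rho * b * D - (1 - rho) ^+ 2 * M <= rho ^+ 2 * H ->
  False.
Proof.
move=> /andP[r0 r1] hb D0 J1 J2 J3.
set g := 1 + rho ^+ 2 in hb J1 J2.
have g0 : 0 < g by rewrite /g ltr_wpDr // sqr_ge0.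
set t := 1 - rho in hb J2 J3.
have t0 : 0 < t by rewrite subr_gt0.
have K1 : 2 * t * (2 * t * rho * b * D - t ^+ 2 * M + 2 * rho^+2 * b * D + rho^+2 * M)
   <= rho * (g * ((2 - rho) * 2 * b ^+ 2 * D + t * (2 - rho) * M)).
  have := ler_wpM2l (ltW r0) J2; apply: le_trans.
  have := ler_wpM2l (ltW t0) J3; lra.
(* After multiplication by [g], [b] enters only through [g * b], which is [rho * t] by [hb]. *)
have K2 : 2 * t * (2 * t * rho * b * D - t ^+ 2 * M + 2 * rho^+2 * b * D + rho^+2 * M) * g
   <= rho * ((2 - rho) * 2 * (g * b) ^+ 2 * D + g ^+ 2 * t * (2 - rho) * M).
  have := ler_wpM2r (ltW g0) K1; lra.
move: K2; rewrite hb => K2.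
have K3 : 2 * t * (2 * t * rho * D * (rho * t) + 2 * rho^+2 * D * (rho * t) + (rho^+2 - t ^+ 2) * (g * M))
   <= rho * ((2 - rho) * 2 * (rho * t) ^+ 2 * D + g * t * (2 - rho) * (g * M)).
  have : 2 * t * (2 * t * rho * D * (rho * t) + 2 * rho^+2 * D * (rho * t) + (rho^+2 - t ^+ 2) * (g * M)) = 2 * t * (2 * t * rho * b * D - t ^+ 2 * M + 2 * rho^+2 * b * D + rho^+2 * M) * g.
    by rewrite -hb; ring.
  by move=> ->; apply: (le_trans K2); rewrite le_eqVlt; apply/orP; left; apply/eqP; ring.
have K4 : 2 * (2 * t * rho * D * (rho * t) + 2 * rho^+2 * D * (rho * t) + (rho^+2 - t ^+ 2) * (g * M))
   <= rho * ((2 - rho) * 2 * rho ^+ 2 * t * D + g * (2 - rho) * (g * M)).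
  rewrite -(ler_pM2l t0); lra.
set Y := g * M in J1 K4.
(* The coefficient of [Y] in [K4] once all terms are on the right; its sign allows [Y] to be
   replaced by the bound [J1]. *)
have coef : 0 <= rho * g * (2 - rho) - 2 * (rho ^+2 - t ^+2).
  have -> : rho * g * (2 - rho) - 2 * (rho ^+2 - t ^+2) =
      rho * (2 - rho) * t ^+ 2 + 2 * rho ^+ 2 * t + 2 * t ^+ 2 by rewrite /g /t; ring.
  have r2 : 0 < 2 - rho by lra.
  by rewrite !addr_ge0 // !mulr_ge0 ?sqr_ge0 // ltW.
have K5 := ler_wpM2l coef J1.
have K6 : 0 <= D * (rho * ((2 - rho) * 2 * rho ^+ 2 * t) - 2 * (2 * t * rho * (rho * t) + 2 * rho^+2 * (rho * t)) + rho ^+2 * (rho * g * (2 - rho) - 2 * (rho ^+2 - t ^+2))) by lra.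
move: K6; rewrite pmulr_rge0 // => K6.
have : rho * ((2 - rho) * 2 * rho ^+ 2 * t) - 2 * (2 * t * rho * (rho * t) + 2 * rho^+2 * (rho * t)) + rho ^+2 * (rho * g * (2 - rho) - 2 * (rho ^+2 - t ^+2)) = - (rho^+2 * (t^+2 + t ^+ 4)).
  rewrite /g /t; ring.
move=> EE; move: K6; rewrite EE oppr_ge0 leNgt => /negP; apply.
by rewrite mulr_gt0 ?addr_gt0 ?exprn_gt0.
Qed.

(** The difference of the two sides is half the sum of all [(f i - f j) ^+ 2]. *)
Lemma cauchy_schwarz_const (R : realFieldType) (I : finType) (T : {set I}) (f : I -> R) :
  (\sum_(i in T) f i) ^+ 2 <= #|T|%:R * \sum_(i in T) f i ^+ 2.
Proof.
have : 0 <= \sum_(i in T) \sum_(j in T) (f i - f j) ^+ 2.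
  by apply: sumr_ge0 => i _; apply: sumr_ge0 => j _; apply: sqr_ge0.
have -> : \sum_(i in T) \sum_(j in T) (f i - f j) ^+ 2 =
   2 * (#|T|%:R * \sum_(i in T) f i ^+ 2) - 2 * (\sum_(i in T) f i) ^+ 2.
  under eq_bigr => i _.
    have -> : \sum_(j in T) (f i - f j) ^+ 2 =
        #|T|%:R * f i ^+ 2 - 2 * f i * (\sum_(j in T) f j) + \sum_(j in T) f j ^+ 2.
      rewrite mulr_natl -sumr_const mulr_sumr -sumrN -!big_split /=.
      by apply: eq_bigr => j _; ring.
    over.
  rewrite !big_split /= sumr_const -mulr_natl -mulr_sumr sumrN -mulr_suml -mulr_sumr.
  by ring.
lra.
Qed.

(** * Spectral gap for a symmetric stochastic kernel *)

Section Kernel.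
Variables (R : realFieldType) (I : finType) (w : I -> I -> R) (rho : R).
Hypotheses (w_ge0 : forall i j, 0 <= w i j) (w_sym : forall i j, w i j = w j i).
Hypothesis w_sum : forall i, \sum_j w i j = 1.
Hypothesis rho01 : 0 < rho < 1.
Hypothesis w_bound : forall f : I -> R, (forall i, 0 <= f i) ->
  #|I|%:R * (\sum_i \sum_j w i j * f i * f j) <= (1 + rho ^+ 2) * (\sum_i f i) ^+ 2.

Let N : R := #|I|%:R.

(* The test function [max 0 (del + v)] is [del + v + h]; dropping the [h]-[h]
   part of the quadratic form only loses a nonnegative term. *)
Lemma truncated_test (v h : I -> R) (del : R) :
  (forall i, \sum_j w i j * v j = rho * v i) -> \sum_i v i = 0 ->
  (forall i, 0 <= h i) -> (forall i, 0 <= del + v i + h i) ->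
  N * (N * del ^+ 2 + 2 * del * (\sum_i h i) + rho * (\sum_i v i ^+ 2)
     + 2 * rho * (\sum_i v i * h i))
  <= (1 + rho ^+ 2) * (N * del + \sum_i h i) ^+ 2.
Proof.
move=> v_eig v_sum h0 f0.
have := w_bound f0.
have -> : \sum_i (del + v i + h i) = N * del + \sum_i h i.
  by rewrite !big_split /= v_sum addr0 sumr_const mulr_natl.
apply: le_trans; apply: ler_wpM2l; first by rewrite ler0n.
have E2 (g : I -> R) : \sum_i \sum_j w i j * g j = \sum_j g j.
  rewrite exchange_big /=; apply: eq_bigr => j _.
  rewrite -mulr_suml; under eq_bigr do rewrite w_sym.
  by rewrite w_sum mul1r.
have E3 (g : I -> R) : \sum_i \sum_j w i j * (v i * g j) = rho * \sum_j v j * g j.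
  rewrite exchange_big mulr_sumr /=; apply: eq_bigr => j _.
  under eq_bigr do rewrite mulrA w_sym.
  by rewrite -mulr_suml v_eig mulrA.
have -> : \sum_i \sum_j w i j * (del + v i + h i) * (del + v j + h j) =
   \sum_i (del ^+ 2 + del * v i + del * h i)
   + del * (\sum_i \sum_j w i j * v j) + del * (\sum_i \sum_j w i j * h j)
   + (\sum_i \sum_j w i j * (v i * v j)) + (\sum_i \sum_j w i j * (v i * h j))
   + (\sum_i \sum_j w j i * (v j * h i)) + \sum_i \sum_j w i j * (h i * h j).
  rewrite !mulr_sumr -!big_split /=; apply: eq_bigr => i _.
  have -> : del ^+ 2 + del * v i + del * h i =
     \sum_j w i j * (del ^+ 2 + del * v i + del * h i).
    by rewrite -mulr_suml w_sum mul1r.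
  rewrite !mulr_sumr -!big_split /=; apply: eq_bigr => j _.
  by rewrite (w_sym j i); ring.
rewrite [X in _ <= _ + X + _]exchange_big /= !E3 !E2 v_sum.
rewrite !big_split /= sumr_const -!mulr_sumr v_sum.
have hh : 0 <= \sum_i \sum_j w i j * (h i * h j).
  by apply: sumr_ge0 => i _; apply: sumr_ge0 => j _; rewrite !mulr_ge0.
have -> : \sum_j v j * v j = \sum_i v i ^+ 2 by apply: eq_bigr => i _; rewrite expr2.
have -> : del ^+ 2 *+ #|I| = N * del ^+ 2 by rewrite mulr_natl.
lra.
Qed.

(** Here [del + v + h] is the positive part of [del + v]. Where [h] is positive, [v = - (del + h)]
    and [m = del], so every mixed sum reduces to the sums of [h] and of its square. *)
Lemma truncated_side (v : I -> R) (b del : R) :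
  (0 < #|I|)%N -> 0 <= del ->
  (forall i, \sum_j w i j * v j = rho * v i) -> \sum_i v i = 0 ->
  let q i := Num.max 0 (- v i) in
  let h i := Num.max 0 (q i - del) in
  let m i := Num.min (q i) del in
  \sum_i h i = N * b * del ->
  [/\ rho * (\sum_i v i ^+ 2) <=
        N * del ^+ 2 * ((1 + rho ^+ 2) * (1 + b) ^+ 2 - 1 - 2 * b)
        + 2 * rho * (\sum_i h i ^+ 2 + N * b * del ^+ 2),
      \sum_i q i ^+ 2 = \sum_i h i ^+ 2 + 2 * (N * b * del ^+ 2) + \sum_i m i ^+ 2,
      \sum_i q i = N * b * del + \sum_i m i &
      \sum_i h i * m i = N * b * del ^+ 2].
Proof.
move=> I0 del0 v_eig v_sum q h m hr.
have N0 : 0 < N by rewrite ltr0n.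
have q0 i : 0 <= q i by rewrite le_max lexx.
have qE i : q i = h i + m i.
  rewrite /h /m /Order.min /Order.max; case: (ltP 0) => ?; case: ltP => ?; lra.
have hm i : h i * m i = del * h i.
  rewrite /h /m /Order.min /Order.max; case: (ltP 0) => ?; case: ltP => ?; lra.
have h0 i : 0 <= h i by rewrite le_max lexx.
have f0 i : 0 <= del + v i + h i.
  by rewrite /h /q /Order.max; case: (ltP 0 (- v i)) => ?; case: ltP => ?; lra.
have vh i : v i * h i = - (h i ^+ 2 + del * h i).
  rewrite /h; case: (ltP 0 (q i - del)) => hq; last by ring.
  have : 0 < q i by lra.
  rewrite /q; case: (ltP 0 (- v i)) => _; rewrite ?ltxx // => _.
  ring.
have Shm : \sum_i h i * m i = N * b * del ^+ 2.
  under eq_bigr do rewrite hm.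
  by rewrite -mulr_sumr hr; ring.
split=> //; last first.
- by rewrite -hr -big_split; apply: eq_bigr => i _; exact: qE.
- under eq_bigr do rewrite qE sqrrD -mulr_natl.
  by rewrite !big_split -mulr_sumr Shm.
have := truncated_test v_eig v_sum h0 f0.
rewrite (eq_bigr _ (fun i _ => vh i)) sumrN big_split -mulr_sumr /= hr.
have -> : (1 + rho ^+ 2) * (N * del + N * b * del) ^+ 2 =
   N * ((1 + rho ^+ 2) * (N * del ^+ 2 * (1 + b) ^+ 2)) by ring.
rewrite ler_pM2l // => K; lra.
Qed.

(** [truncated_side] is used for [v], with negative part [q], and for [- v], whose negative part is
    [p]. These have disjoint supports and equal sums. *)
Lemma kernel_spectral_gap (v : I -> R) :
  (forall i, \sum_j w i j * v j = rho * v i) -> \sum_i v i = 0 ->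
  forall i, v i = 0.
Proof.
move=> v_eig v_sum.
have v'_eig i : \sum_j w i j * (- v j) = rho * (- v i).
  by rewrite mulrN -v_eig -sumrN; apply: eq_bigr => j _; rewrite mulrN.
have v'_sum : \sum_i - v i = 0 by rewrite sumrN v_sum oppr0.
case: (posnP #|I|) => [/card0_eq I0 i|I0]; first by have := I0 i.
have N0 : 0 < N by rewrite ltr0n.
have [r0 r1] := andP rho01.
have g0 : 0 < 1 + rho ^+ 2 by rewrite ltr_wpDr // sqr_ge0.
pose b := rho * (1 - rho) / (1 + rho ^+ 2).
have hb : (1 + rho ^+ 2) * b = rho * (1 - rho) by rewrite /b mulrC divfK // gt_eqF.
have b0 : 0 < b by rewrite /b divr_gt0 // mulr_gt0 // subr_gt0.
pose q i := Num.max 0 (- v i).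
(* The double negation matches the [q] of [truncated_side] for [- v]. *)
pose p i := Num.max 0 (- - v i).
have q0 i : 0 <= q i by rewrite le_max lexx.
have p0 i : 0 <= p i by rewrite le_max lexx.
have vE i : v i = p i - q i.
  by rewrite /p /q /Order.max; case: ltP => ?; case: ltP => ?; lra.
have pq0 i : p i * q i = 0.
  by rewrite /p /q /Order.max; case: ltP => ?; case: ltP => ?; rewrite ?mul0r ?mulr0 //; lra.
have Nb0 : 0 < N * b by rewrite mulr_gt0.
have [dq dq0 hq] := threshold_exists Nb0 q0.
have [dp dp0 hp] := threshold_exists Nb0 p0.
have [Q1 Q2 Q3 Q4] := truncated_side I0 dq0 v_eig v_sum hq.
have [P1 P2 P3 P4] := truncated_side I0 dp0 v'_eig v'_sum hp.
rewrite -/q -/p in Q1 Q2 Q3 Q4 P1 P2 P3 P4 hp hq.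
set hQ := fun i => Num.max 0 (q i - dq) in Q1 Q2 Q3 Q4 hq.
set hP := fun i => Num.max 0 (p i - dp) in P1 P2 P3 P4 hp.
set mQ := fun i => Num.min (q i) dq in Q2 Q3 Q4.
set mP := fun i => Num.min (p i) dp in P2 P3 P4.
have Vpq : \sum_i v i ^+ 2 = \sum_i p i ^+ 2 + \sum_i q i ^+ 2.
  rewrite -big_split; apply: eq_bigr => i _ /=.
  by rewrite vE sqrrB pq0 mul0rn subr0.
have VN : \sum_i (- v i) ^+ 2 = \sum_i v i ^+ 2.
  by apply: eq_bigr => i _; rewrite sqrrN.
have Spq : \sum_i p i = \sum_i q i.
  apply/eqP; rewrite -subr_eq0 -sumrB -[X in _ == X]v_sum; apply/eqP.
  by apply: eq_bigr => i _; rewrite vE.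
pose D := N * dp ^+ 2 + N * dq ^+ 2.
pose H := \sum_i hP i ^+ 2 + \sum_i hQ i ^+ 2.
pose M := \sum_i mP i ^+ 2 + \sum_i mQ i ^+ 2.
(* If [D] is not positive, both levels are zero; the balance equations then say that [p] and [q]
   have sum zero, so [v] vanishes. *)
have [D0|D0] := ltP 0 D; last first.
  have dE d : N * d ^+ 2 <= 0 -> d = 0.
    rewrite pmulr_rle0 // => d2; apply/eqP; rewrite -sqrf_eq0 eq_le d2 /=.
    exact: sqr_ge0.
  have np : 0 <= N * dp ^+ 2 by rewrite mulr_ge0 ?sqr_ge0 ?ltW.
  have nq : 0 <= N * dq ^+ 2 by rewrite mulr_ge0 ?sqr_ge0 ?ltW.
  have dp_0 : dp = 0 by apply: dE; rewrite /D in D0; lra.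
  have dq_0 : dq = 0 by apply: dE; rewrite /D in D0; lra.
  have z (x : I -> R) : (forall i, 0 <= x i) ->
      \sum_i Num.max 0 (x i - 0) = N * b * 0 -> forall i, x i = 0.
    move=> x0; rewrite mulr0 => /psumr_eq0P xz i.
    have := xz (fun i _ => _) i isT; rewrite subr0; move=> <- //.
      by rewrite (max_idPr (x0 i)).
    by move=> j; rewrite le_max lexx.
  move=> i; rewrite vE (z p) ?(z q) ?subrr //.
    by have := hq; rewrite /hQ dq_0.
  by have := hp; rewrite /hP dp_0.
exfalso; apply: (@spectral_gap_numeric R rho b H M D) => //.
(* First inequality: in the sum of the two one-sided estimates the multiples of [H] cancel, which
   leaves a bound on [M]. *)
- rewrite VN Vpq P2 Q2 in P1; rewrite Vpq P2 Q2 in Q1.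
  have K : 2 * rho * (\sum_i hP i ^+ 2 + \sum_i hQ i ^+ 2 + 2 * b * D + M) <=
      D * ((1 + rho ^+ 2) * (1 + b) ^+ 2 - 1 - 2 * b) + 2 * rho * (\sum_i hP i ^+ 2 + \sum_i hQ i ^+ 2 + b * D).
    rewrite /D /M; lra.
  have K2 : 2 * rho * (b * D + M) <= D * ((1 + rho ^+ 2) * (1 + b) ^+ 2 - 1 - 2 * b) by lra.
  have := ler_wpM2l (ltW g0) K2.
  have -> : (1 + rho ^+ 2) * (D * ((1 + rho ^+ 2) * (1 + b) ^+ 2 - 1 - 2 * b)) =
     D * ((1 + rho ^+ 2) * rho ^+ 2 + 2 * rho ^+ 2 * ((1 + rho ^+ 2) * b) + ((1 + rho ^+ 2) * b) ^+ 2) by ring.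
  have -> : (1 + rho ^+ 2) * (2 * rho * (b * D + M)) =
     2 * rho * (((1 + rho ^+ 2) * b) * D + (1 + rho ^+ 2) * M) by ring.
  rewrite hb => K3; rewrite -(ler_pM2l r0); lra.
(* Second inequality: as [v = p - q], the form at [v] is at most the sum of the forms at [p] and
   [q], and [w_bound] controls both through their common sum. *)
- have T1 : N * rho * (\sum_i v i ^+ 2) <= 2 * (1 + rho ^+ 2) * (\sum_i p i) ^+ 2.
    have := w_bound q0; rewrite -Spq; have := w_bound p0.
    suff K : rho * (\sum_i v i ^+ 2) <= (\sum_i \sum_j w i j * p i * p j) + (\sum_i \sum_j w i j * q i * q j).
      have := ler_wpM2l (ltW N0) K; rewrite /N; lra.
    have -> : rho * (\sum_i v i ^+ 2) = \sum_i \sum_j w i j * v i * v j.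
      rewrite mulr_sumr; apply: eq_bigr => i _.
      by rewrite expr2 mulrA mulrAC -v_eig mulr_suml; apply: eq_bigr => j _; ring.
    rewrite -big_split; apply: ler_sum => i _; rewrite -big_split; apply: ler_sum => j _ /=.
    rewrite !vE.
    have : 0 <= w i j * p i * q j by rewrite !mulr_ge0.
    have : 0 <= w i j * q i * p j by rewrite !mulr_ge0.
    lra.
  (* [x] and [y] are the total masses of [p] and [q] above and below the levels. By disjointness of
     supports, Cauchy-Schwarz for [y] costs the factor [N] only once. *)
  pose y := \sum_i (mP i + mQ i).
  pose x := N * b * (dp + dq).
  have xy : x + y = 2 * \sum_i p i.
    by rewrite /x /y big_split /= mulr2n mulrDl mul1r {2}Spq P3 Q3; ring.
  have y2 : y ^+ 2 <= N * M.
    have := cauchy_schwarz_const [set: I] (fun i => mP i + mQ i).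
    rewrite cardsT !(eq_bigl _ _ (@in_setT I)) => /le_trans; apply.
    rewrite ler_pM2l // /M -big_split; apply: ler_sum => i _ /=.
    suff -> : (mP i + mQ i) ^+ 2 = mP i ^+ 2 + mQ i ^+ 2 by [].
    have : (p i == 0) || (q i == 0) by rewrite -mulf_eq0 pq0.
    rewrite /mP /mQ => /orP[] /eqP ->.
      by rewrite (min_idPl dp0); ring.
    by rewrite (min_idPl dq0); ring.
  have x2 : x ^+ 2 <= 2 * N * b ^+ 2 * D.
    rewrite -subr_ge0.
    have -> : 2 * N * b ^+ 2 * D - x ^+ 2 = (N * b) ^+ 2 * (dp - dq) ^+ 2 by rewrite /x /D; ring.
    by rewrite mulr_ge0 ?sqr_ge0.
  pose t := 1 - rho.
  have t0 : 0 < t by rewrite subr_gt0.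
  (* Weighted Cauchy-Schwarz: the sides differ by [(x - t * y) ^+ 2]. *)
  have T2 : t * (x + y) ^+ 2 <= (1 + t) * (x ^+ 2 + t * y ^+ 2).
    by have := sqr_ge0 (x - t * y); lra.
  have T3 : t * (x + y) ^+ 2 <= (1 + t) * (2 * N * b ^+ 2 * D + t * (N * M)).
    apply: (le_trans T2); apply: ler_wpM2l; first by rewrite addr_ge0 ?ler01 // ltW.
    by apply: lerD => //; apply: ler_wpM2l => //; exact: ltW.
  have T4 : 2 * t * (N * rho * \sum_i v i ^+ 2) <= (1 + rho ^+ 2) * (t * (x + y) ^+ 2).
    have := ler_wpM2l (ltW t0) T1; rewrite xy; lra.
  have T5 := le_trans T4 (ler_wpM2l (ltW g0) T3).
  rewrite -(ler_pM2l N0).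
  rewrite Vpq P2 Q2 in T5; rewrite /H /M /D /t in T5 *; lra.
(* Third inequality: these squares are expanded, with [P4] and [Q4] evaluating the cross terms. *)
- have K : 0 <= \sum_i (rho * hP i - (1 - rho) * mP i) ^+ 2 by apply: sumr_ge0 => i _; exact: sqr_ge0.
  have K' : 0 <= \sum_i (rho * hQ i - (1 - rho) * mQ i) ^+ 2 by apply: sumr_ge0 => i _; exact: sqr_ge0.
  have Ex (h m : I -> R) : \sum_i (rho * h i - (1 - rho) * m i) ^+ 2 =
     rho ^+ 2 * (\sum_i h i ^+ 2) - 2 * rho * (1 - rho) * (\sum_i h i * m i) + (1 - rho) ^+ 2 * (\sum_i m i ^+ 2).
    by rewrite !mulr_sumr -sumrN -!big_split; apply: eq_bigr => i _ /=; ring.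
  rewrite Ex P4 in K; rewrite Ex Q4 in K'; rewrite /D /H /M; lra.
Qed.
End Kernel.

(** * Rayleigh quotients of symmetric matrices by Householder deflation *)

Definition dotv (R : pzRingType) (n : nat) (x y : 'rV[R]_n) : R := (x *m y^T) 0 0.

Lemma mulmx_rowcol (R : pzRingType) (n : nat) (x y : 'rV[R]_n) :
  x *m y^T = (dotv x y)%:M.
Proof. by rewrite [LHS]mx11_scalar. Qed.

Lemma dotvE (R : pzRingType) (n : nat) (x y : 'rV[R]_n) :
  dotv x y = \sum_i x 0 i * y 0 i.
Proof. by rewrite /dotv mxE; apply: eq_bigr => i _; rewrite mxE. Qed.

Lemma dotvv_ge0 (R : realDomainType) (n : nat) (x : 'rV[R]_n) : 0 <= dotv x x.
Proof. by rewrite dotvE sumr_ge0 // => i _; rewrite -expr2 sqr_ge0. Qed.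

Lemma dotvv_eq0 (R : realDomainType) (n : nat) (x : 'rV[R]_n) :
  (dotv x x == 0) = (x == 0).
Proof.
apply/eqP/eqP => [|->]; last by rewrite /dotv mul0mx mxE.
rewrite dotvE => /psumr_eq0P xx; apply/rowP => i; rewrite mxE.
apply/eqP; rewrite -sqrf_eq0 expr2; apply/eqP/xx => // j _.
by rewrite -expr2 sqr_ge0.
Qed.

Lemma dotvC (R : comPzRingType) (n : nat) (x y : 'rV[R]_n) : dotv x y = dotv y x.
Proof. by rewrite !dotvE; apply: eq_bigr => i _; rewrite mulrC. Qed.

Lemma dotv_row_mx (R : pzRingType) (m n : nat) (x1 y1 : 'rV[R]_m) (x2 y2 : 'rV[R]_n) :
  dotv (row_mx x1 x2) (row_mx y1 y2) = dotv x1 y1 + dotv x2 y2.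
Proof. by rewrite /dotv tr_row_mx mul_row_col mxE. Qed.

(** The Householder reflection that exchanges the unit vector along [u] with the first basis vector;
    [k] is the norm of [u]. *)
Lemma reflection_exists (R : rcfType) (n : nat) (u : 'rV[R]_(1 + n)) : u != 0 ->
  exists (H : 'M[R]_(1 + n)) (k : R),
  [/\ H *m H = 1%:M, H^T = H & u = k *: (delta_mx 0 0 *m H)].
Proof.
move=> u0.
have uu0 : 0 < dotv u u by rewrite lt_def dotvv_eq0 u0 dotvv_ge0.
pose k := Num.sqrt (dotv u u).
have k0 : 0 < k by rewrite sqrtr_gt0.
pose u1 := k^-1 *: u.
have u11 : dotv u1 u1 = 1.
  have -> : dotv u1 u1 = k^-1 * k^-1 * dotv u u.
    by rewrite !dotvE mulr_sumr; apply: eq_bigr => i _; rewrite !mxE; ring.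
  rewrite -[dotv u u]sqr_sqrtr ?ltW // -/k; field; exact: lt0r_neq0.
pose e : 'rV[R]_(1 + n) := delta_mx 0 0.
have ee : dotv e e = 1.
  by rewrite /dotv trmx_delta mul_delta_mx mxE !eqxx.
pose w := u1 - e.
(* If [w = 0], division by zero gives [c = 0] and the reflection becomes the identity, as it
   should. *)
pose c := 2 / dotv w w.
have ew : dotv e w = dotv u1 e - 1.
  by rewrite [dotv u1 e]dotvC -ee !dotvE -sumrB; apply: eq_bigr => i _; rewrite !mxE; ring.
have ww : dotv w w = - 2 * dotv e w.
  rewrite ew mulrBr mulr1 opprK.
  have -> : dotv w w = dotv u1 u1 - dotv u1 e - dotv e u1 + dotv e e.
    by rewrite !dotvE -!sumrB -big_split; apply: eq_bigr => i _; rewrite !mxE /=; ring.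
  by rewrite (dotvC e) u11 ee; ring.
have ccw : c * c * dotv w w = 2 * c.
  rewrite /c; have [->|w0] := eqVneq (dotv w w) 0; first by rewrite invr0 !mulr0.
  by field.
have cw : (c * dotv e w) *: w = - w.
  have [w0|w0] := eqVneq w 0; first by rewrite w0 scaler0 oppr0.
  have : dotv w w != 0 by rewrite dotvv_eq0.
  rewrite -scaleN1r => w1; congr (_ *: _); move: w1.
  by rewrite /c ww mulf_eq0 negb_or => /andP[_ w1]; field.
have u1E : u1 = e + w by rewrite /w addrC subrK.
have uE : u = k *: u1 by rewrite /u1 scalerA mulfV ?scale1r // gt_eqF.
clearbody w c u1.
exists (1%:M - c *: (w^T *m w)), k; split.
- rewrite mulmxBl mul1mx mulmxBr mulmx1 -!scalemxAl -!scalemxAr.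
  rewrite mulmxA -(mulmxA w^T w w^T) mulmx_rowcol mul_mx_scalar.
  rewrite -scalemxAl !scalerA ?mulrA ccw mulr_natl mulr2n scalerDl.
  by rewrite opprB addrK subrK.
- by rewrite linearB linearZ /= trmx1 trmx_mul trmxK.
- by rewrite mulmxBr mulmx1 -scalemxAr mulmxA mulmx_rowcol mul_scalar_mx scalerA cw opprK -u1E.
Qed.

(** Conjugating by the reflection makes the first basis vector an eigenvector. This clears the rest
    of the first row, and symmetry clears the first column. *)
Lemma deflation (R : rcfType) (n : nat) (A : 'M[R]_(1 + n)) (u : 'rV_(1 + n)) (a : R) :
  A^T = A -> u != 0 -> u *m A = a *: u ->
  exists (H : 'M[R]_(1 + n)) (k : R) (B : 'M[R]_n),
  [/\ H *m H = 1%:M, H^T = H, u = k *: (delta_mx 0 0 *m H), B^T = B &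
    H *m A *m H = block_mx a%:M 0 0 B] /\
  char_poly A = ('X - a%:P) * char_poly B.
Proof.
move=> sA u0 uA; have [H [k [HH sH uE]]] := reflection_exists u0.
have k0 : k != 0 by apply: contraNneq u0 => k0; rewrite uE k0 scale0r.
pose e : 'rV[R]_(1 + n) := delta_mx 0 0.
pose C := H *m A *m H.
have sC : C^T = C by rewrite /C !trmx_mul sH sA mulmxA.
have eC : e *m C = a *: e.
  have eH : e *m H = k^-1 *: u by rewrite uE scalerA mulVf // scale1r.
  have uH : u *m H = k *: e by rewrite uE -scalemxAl -mulmxA HH mulmx1.
  rewrite /C !mulmxA eH -!scalemxAl uA -scalemxAl uH !scalerA.
  by congr (_ *: _); field.
have rC j : C 0 j = a * (j == 0)%:R.
  by have /rowP/(_ j) := eC; rewrite -rowE !mxE eqxx.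
have CE : C = block_mx a%:M 0 0 (drsubmx C).
  rewrite -[LHS]submxK; congr block_mx; apply/matrixP => i j.
  - rewrite [LHS]mxE [LHS]mxE (ord1 i) (ord1 j) lshift0.
    by rewrite rC !mxE !eqxx mulr1 mulr1n.
  - rewrite [LHS]mxE [LHS]mxE (ord1 i) lshift0 rC mxE.
    by rewrite -(inj_eq val_inj) /= mulr0.
  - rewrite [LHS]mxE [LHS]mxE -sC [LHS]mxE (ord1 j) lshift0 rC mxE.
    by rewrite -(inj_eq val_inj) /= mulr0.
exists H, k, (drsubmx C); split.
  by split=> //; rewrite -{2}sC; apply/matrixP => i j; rewrite !mxE.
have -> : char_poly A = char_poly C.
  rewrite /char_poly /char_poly_mx.
  pose Hp := map_mx polyC H.
  have HHp : Hp *m Hp = 1%:M by rewrite -map_mxM HH map_mx1.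
  have -> : 'X%:M - map_mx polyC C = Hp *m ('X%:M - map_mx polyC A) *m Hp.
    rewrite mulmxBr mulmxBl -!map_mxM; congr (_ - _).
    by rewrite mul_mx_scalar -scalemxAl HHp scalemx1.
  by rewrite !det_mulmx mulrAC -det_mulmx HHp det1 mul1r.
rewrite {1}CE /char_poly /char_poly_mx map_block_mx !map_mx0 map_scalar_mx.
rewrite (@scalar_mx_block _ 1 n) opp_block_mx add_block_mx !oppr0 !addr0.
by rewrite det_ublock det_mx11 !mxE mulr1n.
Qed.

(** Induction on the list of roots: deflation preserves dot products and leaves a smaller symmetric
    matrix with the remaining roots. *)
Lemma rayleigh_le (R : rcfType) (c : R) (s : seq R) (n : nat) (A : 'M[R]_n) :
  A^T = A -> char_poly A = \prod_(x <- s) ('X - x%:P) -> all (<= c) s ->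
  forall x : 'rV_n, dotv (x *m A) x <= c * dotv x x.
Proof.
elim: s n A => [|a s IHs] [|n] A sA pA sc x.
- by rewrite !dotvE !big_ord0 mulr0.
- by have := size_char_poly A; rewrite pA big_nil size_poly1.
- by rewrite !dotvE !big_ord0 mulr0.
have /eigenvalueP[u uA u0] : eigenvalue A a.
  by rewrite eigenvalue_root_char pA big_cons rootM root_XsubC eqxx.
have [H [k [B [[HH sH uE sB HAH] pB]]]] := @deflation R n A u a sA u0 uA.
have pBs : char_poly B = \prod_(x <- s) ('X - x%:P).
  apply: (@mulfI _ ('X - a%:P)); first by rewrite polyXsubC_eq0.
  by rewrite -pB pA big_cons.
have /andP[ac sc'] := sc.
pose y := x *m H.
have xE : x = y *m H by rewrite /y -mulmxA HH mulmx1.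
have -> : dotv x x = dotv y y.
  by rewrite /dotv xE trmx_mul sH mulmxA -(mulmxA y) HH mulmx1.
have -> : dotv (x *m A) x = dotv (y *m block_mx a%:M 0 0 B) y.
  rewrite -HAH /dotv /y !trmx_mul sH !mulmxA.
  by rewrite -!(mulmxA _ H H) HH !mulmx1.
move: y {xE} => y; rewrite -(@hsubmxK _ 1 1 n y).
set y1 := lsubmx _; set y2 := rsubmx _.
rewrite mul_row_block !mulmx0 addr0 add0r !dotv_row_mx mulrDr.
apply: lerD; last exact: IHs.
rewrite mul_mx_scalar /dotv -scalemxAl mxE.
by apply: ler_wpM2r => //; exact: dotvv_ge0.
Qed.

(** The reflection carries the orthogonal complement of [u] to the vectors with first coordinate
    zero, on which [A] acts as a symmetric matrix with roots [s]. *)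
Lemma second_eigen (R : rcfType) (n : nat) (A : 'M[R]_n) (u : 'rV_n) (a : R) (s : seq R) :
  A^T = A -> u != 0 -> u *m A = a *: u ->
  char_poly A = \prod_(x <- a :: s) ('X - x%:P) ->
  (forall c, all (<= c) s ->
     forall x : 'rV_n, dotv x u = 0 -> dotv (x *m A) x <= c * dotv x x) /\
  (forall l, l \in s -> exists v : 'rV_n, [/\ v != 0, v *m A = l *: v & dotv v u = 0]).
Proof.
case: n A u => [|n] A u sA u0 uA pA.
  by case/eqP: u0; apply/rowP => -[].
have [H [k [B [[HH sH uE sB HAH] pB]]]] := @deflation R n A u a sA u0 uA.
have k0 : k != 0 by apply: contraNneq u0 => k0; rewrite uE k0 scale0r.
have pBs : char_poly B = \prod_(x <- s) ('X - x%:P).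
  apply: (@mulfI _ ('X - a%:P)); first by rewrite polyXsubC_eq0.
  by rewrite -pB pA big_cons.
have dot_u (y : 'rV[R]_(1 + n)) : dotv (y *m H) u = k * y 0 0.
  rewrite uE /dotv linearZ /= trmx_mul sH -scalemxAr -mulmxA.
  rewrite (mulmxA H) HH mul1mx trmx_delta -colE !mxE.
  by [].
split=> [c sc x xu|l ls].
  pose y := x *m H.
  have xE : x = y *m H by rewrite /y -mulmxA HH mulmx1.
  have y00 : y 0 0 = 0.
    by apply/eqP; have /eqP := xu; rewrite xE dot_u mulf_eq0 (negPf k0).
  have -> : dotv x x = dotv y y.
    by rewrite /dotv xE trmx_mul sH mulmxA -(mulmxA y) HH mulmx1.
  have -> : dotv (x *m A) x = dotv (y *m block_mx a%:M 0 0 B) y.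
    rewrite -HAH /dotv /y !trmx_mul sH !mulmxA.
    by rewrite -!(mulmxA _ H H) HH !mulmx1.
  have -> : y = row_mx 0 (@rsubmx _ 1 1 n y).
    rewrite -[LHS](@hsubmxK _ 1 1 n y); congr row_mx.
    by apply/rowP => i; rewrite [LHS]mxE [RHS]mxE (ord1 i) lshift0.
  rewrite mul_row_block !mulmx0 mul0mx addr0 add0r !dotv_row_mx.
  by rewrite {1 3}/dotv !mul0mx !mxE !add0r; exact: (rayleigh_le sB pBs).
have /eigenvalueP[y yB y0] : eigenvalue B l.
  by rewrite eigenvalue_root_char pBs root_prod_XsubC.
have AE : A = H *m block_mx a%:M 0 0 B *m H.
  by rewrite -HAH !mulmxA HH mul1mx -mulmxA HH mulmx1.
exists (row_mx 0 y *m H); split.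
- apply: contraNneq y0 => yH.
  have : row_mx (0 : 'M_(1, 1)) y *m H *m H = 0 by rewrite yH mul0mx.
  rewrite -mulmxA HH mulmx1 => /(congr1 rsubmx).
  by rewrite row_mxKr => ->; apply/eqP/matrixP => i j; rewrite !mxE.
- rewrite AE !mulmxA -(mulmxA _ H H) HH mulmx1 mul_row_block.
  by rewrite !mulmx0 mul0mx !addr0 add0r yB scalemxAl scale_row_mx scaler0.
- by rewrite dot_u -[X in row_mx _ _ _ X](lshift0 n 0) row_mxEl mxE mulr0.
Qed.

(** * Cliques and the Motzkin-Straus inequality *)

Section Graph.
Variables (n : nat) (e : rel 'I_n).
Hypotheses (e_sym : symmetric e) (e_irr : irreflexive e).

Local Notation omega := (clique_number e).

Lemma cliqueP (Q : {set 'I_n}) :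
  reflect {in Q &, forall x y, x != y -> e x y} (is_clique e Q).
Proof.
apply: (iffP idP) => [Qc x y xQ yQ xy|Qc].
  by move/forallP/(_ x): Qc; rewrite xQ /= => /forallP/(_ y); rewrite yQ xy.
by apply/forall_inP => x xQ; apply/forall_inP => y yQ; apply/implyP; apply: Qc.
Qed.

Lemma clique_card_le (Q : {set 'I_n}) : is_clique e Q -> (#|Q| <= omega)%N.
Proof. by move=> Qc; rewrite /clique_number (bigD1 Q) //= leq_maxl. Qed.

Lemma clique1 (x : 'I_n) : is_clique e [set x].
Proof. by apply/cliqueP => y z; rewrite !inE => /eqP -> /eqP ->; rewrite eqxx. Qed.

Lemma clique_number_gt0 : (0 < n)%N -> (0 < omega)%N.
Proof. by move=> n0; have := clique_card_le (clique1 (Ordinal n0)); rewrite cards1. Qed.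

Lemma clique_setU1 (Q : {set 'I_n}) (u : 'I_n) :
  is_clique e Q -> {in Q, forall x, x != u -> e u x} -> is_clique e (u |: Q).
Proof.
move=> /cliqueP Qc uQ; apply/cliqueP => x y; rewrite !inE.
case/orP=> [/eqP ->|xQ]; case/orP=> [/eqP ->|yQ] xy; first by rewrite eqxx in xy.
- by apply: uQ => //; rewrite eq_sym.
- by rewrite e_sym; apply: uQ.
- exact: Qc.
Qed.

Lemma complete_isomorphic :
  (forall x y, x != y -> e x y) -> isomorphic e (complete_rel omega).
Proof.
move=> ec; have Tc : is_clique e setT by apply/cliqueP => x y _ _; apply: ec.
have -> : omega = n.
  apply/eqP; rewrite eqn_leq; apply/andP; split; last first.
    by have := clique_card_le Tc; rewrite cardsT card_ord.
  by apply/bigmax_leqP => Q _; rewrite -[X in (_ <= X)%N]card_ord max_card.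
exists id; split; first by exists id.
move=> x y; rewrite /complete_rel; case: eqVneq => [->|/ec //].
by rewrite e_irr.
Qed.

Lemma sum_delta (R : pzRingType) (x : 'I_n) (F : 'I_n -> R) :
  \sum_i (i == x)%:R * F i = F x.
Proof.
rewrite (bigD1 x) //= eqxx mul1r big1 ?addr0 // => i /negPf ->.
by rewrite mul0r.
Qed.

Section MotzkinStraus.
Variable R : realFieldType.
Implicit Types f : 'I_n -> R.

Let adj f i := \sum_j (e i j)%:R * f j.
Let form f := \sum_i f i * adj f i.

(** On a clique the form is [(\sum_i f i) ^+ 2 - \sum_i f i ^+ 2]. Cauchy-Schwarz over the support,
    which has at most [omega] vertices, bounds the subtracted sum from below. *)
Lemma clique_form f : (forall i, 0 <= f i) -> is_clique e [set i | f i != 0] ->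
  omega%:R * form f <= (omega%:R - 1) * (\sum_i f i) ^+ 2.
Proof.
move=> f0 Tc; set T := [set i | f i != 0] in Tc.
have TE k : \sum_(i in T) f i ^+ k.+1 = \sum_i f i ^+ k.+1.
  rewrite big_mkcond; apply: eq_bigr => i _.
  by rewrite inE; case: eqVneq => //= ->; rewrite exprS mul0r.
have E : form f = (\sum_i f i) ^+ 2 - \sum_i f i ^+ 2.
  rewrite expr2 mulr_suml -sumrB; apply: eq_bigr => i _.
  rewrite expr2 -mulrBr; have [->|fi] := eqVneq (f i) 0; first by rewrite !mul0r.
  congr (_ * _); rewrite /adj -[X in _ - X](sum_delta i) -sumrB.
  apply: eq_bigr => j _; have [->|fj] := eqVneq (f j) 0; first by rewrite !mulr0 subr0.
  case: (eqVneq j i) => [->|ji]; first by rewrite e_irr !(mul0r, mul1r) subrr.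
  have -> : e i j by move/cliqueP: Tc; apply; rewrite ?inE // eq_sym.
  by rewrite mul1r mul0r subr0.
have C := cauchy_schwarz_const T f.
have T2 := TE 1%N; have T1 : \sum_(i in T) f i = \sum_i f i := TE 0%N.
rewrite T1 T2 in C; rewrite E.
have TT : (#|T|%:R : R) * (\sum_i f i ^+ 2) <= omega%:R * (\sum_i f i ^+ 2).
  apply: ler_wpM2r; first by apply: sumr_ge0 => i _; apply: sqr_ge0.
  by rewrite ler_nat clique_card_le.
lra.
Qed.

(** A term in [t ^+ 2] would involve only the adjacency entries among [x] and [y], and these are all
    zero. *)
Lemma form_shift f (x y : 'I_n) (t : R) : ~~ e x y ->
  form (fun i => f i + t * ((i == x)%:R - (i == y)%:R)) =
  form f + 2 * t * (adj f x - adj f y).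
Proof.
move=> nxy; set f' := fun i => _.
have adjE i : adj f' i = adj f i + t * ((e i x)%:R - (e i y)%:R).
  rewrite -(sum_delta x (fun j => (e i j)%:R)) -(sum_delta y (fun j => (e i j)%:R)).
  rewrite -sumrB mulr_sumr -big_split; apply: eq_bigr => j _ /=.
  by rewrite /f'; ring.
have ax : adj f' x = adj f x by rewrite adjE e_irr (negPf nxy) subrr mulr0 addr0.
have ay : adj f' y = adj f y by rewrite adjE e_irr e_sym (negPf nxy) subrr mulr0 addr0.
have -> : form f' = \sum_i f' i * adj f i + t * (adj f' x - adj f' y).
  rewrite -sumrB mulr_sumr -big_split; apply: eq_bigr => i _ /=.
  by rewrite adjE (e_sym i x) (e_sym i y); ring.
rewrite ax ay.
have -> : \sum_i f' i * adj f i = form f + t * (adj f x - adj f y).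
  rewrite -(sum_delta x (adj f)) -(sum_delta y (adj f)).
  rewrite -sumrB mulr_sumr -big_split; apply: eq_bigr => i _ /=.
  by rewrite /f'; ring.
by ring.
Qed.

(* The form is linear along a shift of weight between two nonadjacent
   vertices, so one of them can be emptied without decreasing it. *)
Lemma motzkin_straus f : (forall i, 0 <= f i) ->
  omega%:R * form f <= (omega%:R - 1) * (\sum_i f i) ^+ 2.
Proof.
have [k] := ubnP #|[set i | f i != 0]|; elim: k f => // k IHk f; rewrite ltnS => fk f0.
have [/clique_form|] := boolP (is_clique e [set i | f i != 0]); first exact.
rewrite negb_forall_in => /exists_inP[x xT].
rewrite negb_forall_in => /exists_inP[y yT]; rewrite negb_imply => /andP[].
rewrite !inE in xT yT.
wlog le_yx : x y xT yT / adj f y <= adj f x => [hw xy nxy|xy nxy].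
  case: (leP (adj f y) (adj f x)) => [|/ltW] h; first exact: (hw x y).
  by apply: (hw y x) => //; rewrite 1?eq_sym // e_sym.
pose f' i := f i + f y * ((i == x)%:R - (i == y)%:R).
have f'0 i : 0 <= f' i.
  rewrite /f'; case: (eqVneq i y) => [->|_].
    by rewrite eq_sym (negPf xy) sub0r mulrN1 subrr.
  by rewrite subr0 addr_ge0 // mulr_ge0.
have Sf : \sum_i f' i = \sum_i f i.
  rewrite big_split -mulr_sumr sumrB /=.
  have d1 z : \sum_(i < n) ((i == z)%:R : R) = 1.
    by rewrite -[RHS](sum_delta z (fun=> 1)); apply: eq_bigr => i _; rewrite mulr1.
  by rewrite !d1 subrr mulr0 addr0.
have := IHk f' _ f'0; rewrite Sf => H.
apply: le_trans (H _).
  apply: ler_wpM2l; first by rewrite ler0n.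
  rewrite form_shift // ler_wpDr // !mulr_ge0 // subr_ge0 //.
apply: leq_trans fk; apply: proper_card; apply/properP; split.
  apply/subsetP => i; rewrite !inE /f'; apply: contraNneq => fi.
  rewrite fi; case: (eqVneq i y) fi => [-> fy|iy fi]; first by rewrite fy mul0r addr0.
  case: (eqVneq i x) fi => [-> fx|ix fi]; first by rewrite fx eqxx in xT.
  by rewrite subrr mulr0 addr0.
exists y; rewrite !inE //.
by rewrite /f' eqxx (eq_sym y x) (negPf xy) sub0r mulrN1 subrr eqxx.
Qed.
End MotzkinStraus.
End Graph.

(** * Turan's bound for regular graphs and its equality case *)

Section RegularGraph.
Variables (n : nat) (e : rel 'I_n) (d : nat).
Hypotheses (e_sym : symmetric e) (e_irr : irreflexive e).
Hypothesis e_deg : forall v : 'I_n, #|[set w | e v w]| = d.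

Local Notation omega := (clique_number e).

Lemma handshake : (2 * num_edges e = n * d)%N.
Proof.
pose E := [set A : {set 'I_n} | [exists x, exists y, (A == [set x; y]) && e x y]].
have EP A : reflect (exists x y, A = [set x; y] /\ e x y) (A \in E).
  rewrite inE; apply: (iffP existsP) => [[x /existsP[y /andP[/eqP-> exy]]]|[x [y [-> exy]]]].
    by exists x, y.
  by exists x; apply/existsP; exists y; rewrite eqxx.
have degE x : #|[set A in E | x \in A]| = d.
  rewrite -(e_deg x) -(@card_in_imset _ _ (fun y => [set x; y])); last first.
    move=> y z; rewrite !inE => exy exz /setP/(_ y); rewrite !inE eqxx orbT.
    by case: eqVneq => [yx|_] /esym //= /eqP //; move: exy; rewrite yx e_irr.
  apply: eq_card => A; rewrite inE; apply/andP/imsetP => [[/EP[y [z [-> eyz]]]]|].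
    rewrite !inE => /orP[] /eqP ->; first by exists z; rewrite ?inE.
    by exists y; rewrite ?inE 1?e_sym // setUC.
  case=> y; rewrite inE => exy ->; split; last by rewrite !inE eqxx.
  by apply/EP; exists x, y.
have -> : (n * d = \sum_(x < n) \sum_(A in E) (x \in A))%N.
  rewrite (eq_bigr (fun=> d)); first by rewrite sum_nat_const card_ord.
  move=> x _; rewrite -(degE x) -sum1_card /=.
  rewrite [RHS](eq_bigl (fun A => (A \in E) && (x \in A))); last by move=> A; rewrite inE.
  by rewrite [RHS]big_mkcondr /=; apply: eq_bigr => A _; case: (x \in A).
rewrite exchange_big /= (eq_bigr (fun=> 2%N)).
  by rewrite sum_nat_const mulnC.
move=> A /EP[x [y [-> exy]]].
have xy : x != y by apply: contraTneq exy => ->; rewrite e_irr.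
have <- : #|[set x; y]| = 2%N by rewrite cards2 xy.
rewrite -sum1_card [RHS]big_mkcond /=.
by apply: eq_bigr => z _; case: (z \in _).
Qed.

Section ClosedSet.
Variable S : {set 'I_n}.
Hypothesis S_closed : forall x y, x \in S -> e x y -> y \in S.

(** Double counting between the family [r] and [S]: as [S] is a union of connected components, all
    [d] neighbours of [r j] lie in it. *)
Lemma count_neighbours (J : finType) (P : {pred J}) (r : J -> 'I_n) :
  (forall j, j \in P -> r j \in S) ->
  (#|P| * d = \sum_(u in S) \sum_(j in P) e (r j) u)%N.
Proof.
move=> rS; rewrite exchange_big /= -sum_nat_const; apply: eq_bigr => j jP.
rewrite -(e_deg (r j)) -sum1_card [RHS]big_mkcond [LHS]big_mkcond /=.
apply: eq_bigr => u _; rewrite inE; case: ifP => eju; last by case: ifP.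
by rewrite (S_closed (rS _ jP) eju).
Qed.

(** Each [u] in [S] is adjacent to every representative except [r (c u)], so it contributes [k - 1]
    to the count. *)
Lemma multipartite_count (k : nat) (r : 'I_k -> 'I_n) (c : 'I_n -> 'I_k) :
  (forall j, r j \in S) -> (forall j u, u \in S -> e (r j) u = (j != c u)) ->
  (#|S| + k * d = k * #|S|)%N.
Proof.
move=> rS rc; have := @count_neighbours _ predT r (fun j _ => rS j).
rewrite cardT size_enum_ord => ->.
rewrite -{1}sum1_card -big_split mulnC -sum_nat_const /=.
apply: eq_bigr => u uS.
rewrite (bigD1 (c u)) //= (rc _ _ uS) eqxx add0n.
rewrite (eq_bigr (fun=> 1%N)); last by move=> j ju; rewrite rc // ju.
by rewrite -[RHS]card_ord -sum1_card [RHS](bigD1 (c u)).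
Qed.

(** [Q] is a largest clique inside [S]. No vertex of [S] extends it, so each one has at most
    [#|Q| - 1] neighbours in [Q]. *)
Lemma clique_in_bound : S != set0 ->
  exists Q : {set 'I_n}, [/\ Q \subset S, is_clique e Q,
    (0 < #|Q| <= omega)%N & (#|S| + #|Q| * d <= #|Q| * #|S|)%N].
Proof.
case/set0Pn => x0 x0S.
pose P (Q : {set 'I_n}) := (Q \subset S) && is_clique e Q.
have P0 : P [set x0] by rewrite /P sub1set x0S clique1.
case: (arg_maxnP (fun Q : {set 'I_n} => #|Q|) P0) => Q /andP[QS Qc] Qmax.
have Q1 : (0 < #|Q|)%N by have := Qmax _ P0; rewrite cards1.
exists Q; split=> //; first by rewrite Q1 clique_card_le.
rewrite (@count_neighbours _ (mem Q) id); last by move=> j; apply: (subsetP QS).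
rewrite -{1}sum1_card -big_split mulnC -sum_nat_const /=.
apply: leq_sum => u uS; rewrite add1n.
have [/existsP[x /andP[xQ nxu]]|/existsPn all_adj] :=
    boolP [exists x, (x \in Q) && ~~ e x u].
  rewrite -sum1_card (bigD1 x) //= (negPf nxu) add0n [X in (_ <= X)%N](bigD1 x) //=.
  by rewrite ltnS; apply: leq_sum => j _; case: (e j u).
exfalso; have adjQ x : x \in Q -> e x u.
  by move=> xQ; have := all_adj x; rewrite xQ /= negbK.
have uQ : u \notin Q by apply/negP => /adjQ; rewrite e_irr.
have := Qmax (u |: Q); rewrite /P subUset sub1set uS QS /= cardsU1 uQ add1n ltnn.
by move=> h; apply: notF; apply: h; apply: clique_setU1 => // x xQ _; rewrite e_sym adjQ.
Qed.

Lemma turan_closed_bound : S != set0 -> (#|S| + omega * d <= omega * #|S|)%N.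
Proof.
by move=> S0; have [Q [_ _ /andP[q0 qw] qS]] := clique_in_bound S0; nia.
Qed.

Hypotheses (S_neq0 : S != set0) (S_eq : (#|S| + omega * d = omega * #|S|)%N).

Definition top_clique (Q : {set 'I_n}) := [&& Q \subset S, is_clique e Q & #|Q| == omega].

(** If the clique of [clique_in_bound] had fewer than [omega] vertices, its inequality would
    contradict [S_eq]. *)
Lemma top_clique_exists : exists Q, top_clique Q.
Proof.
have [Q [QS Qc /andP[q0 qw] qS]] := clique_in_bound S_neq0.
exists Q; rewrite /top_clique QS Qc eqn_leq qw /=.
have S0 : (0 < #|S|)%N by rewrite card_gt0.
move: (#|Q|) q0 qw qS => q q0 qw qS; nia.
Qed.

(** Equality in the double count forces exactly one nonneighbour in [Q]; for a vertex of [Q] it is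
    the vertex itself. *)
Lemma top_clique_nonadj Q u : top_clique Q -> u \in S ->
  exists2 x, x \in Q /\ ~~ e u x & {in Q, forall y, y != x -> e u y}.
Proof.
case/and3P => QS Qc /eqP Qw uS.
have w0 : (0 < omega)%N by apply: clique_number_gt0; case: (n) u {uS} => // -[].
have noext v : v \in S -> exists2 x, x \in Q & ~~ e v x.
  move=> vS; apply/exists_inP; rewrite -negb_forall_in; apply/negP => /forall_inP adjQ.
  have vQ : v \notin Q by apply/negP => /adjQ; rewrite e_irr.
  have := clique_card_le (clique_setU1 e_sym Qc (fun x xQ _ => adjQ x xQ)).
  by rewrite cardsU1 vQ Qw add1n ltnn.
have le v : v \in S -> (\sum_(x in Q) e x v <= omega.-1)%N.
  move=> /noext[x xQ nvx]; rewrite -ltnS prednK // -Qw -sum1_card (bigD1 x) //=.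
  rewrite e_sym (negPf nvx) add0n [X in (_ < X)%N](bigD1 x) //= ltnS.
  by apply: leq_sum => j _; case: (e j v).
have eqs := @count_neighbours _ (mem Q) id (fun j => subsetP QS j).
have tot : (\sum_(v in S) \sum_(x in Q) e x v = \sum_(v in S) omega.-1)%N.
  by rewrite -eqs Qw sum_nat_const; nia.
have [x xQ nux] := noext u uS; exists x => // y yQ yx; apply/negPn/negP => nuy.
(* A second nonneighbour [y] of [u] would push the total strictly below the value [tot]. *)
have : (\sum_(v in S) \sum_(x in Q) e x v < \sum_(v in S) omega.-1)%N.
  rewrite (bigD1 u) //= [X in (_ < X)%N](bigD1 u) //= -addSn leq_add //.
    rewrite -ltnS prednK // -Qw -sum1_card (bigD1 x) //= e_sym (negPf nux) add0n.
    rewrite [X in (_ < X)%N](bigD1 x) //= add1n ltnS.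
    rewrite (bigD1 y) ?yQ //= e_sym (negPf nuy) add0n [X in (_ < X)%N](bigD1 y) ?yQ //=.
    by rewrite ltnS; apply: leq_sum => j _; case: (e j u).
  by apply: leq_sum => v /andP[vS _]; apply: le.
by rewrite tot ltnn.
Qed.

Lemma top_clique_uniq Q u x : top_clique Q -> u \in S -> x \in Q -> ~~ e u x ->
  {in Q, forall y, y != x -> e u y}.
Proof.
move=> Qt uS xQ nux y yQ yx; have [z [zQ nuz] zu] := top_clique_nonadj Qt uS.
apply: (zu) => //; suff <- : x = z by [].
by apply/eqP/negPn/negP => xz; have := zu x xQ xz; rewrite (negPf nux).
Qed.

(** [u] is adjacent to all of [Q] but [x], so it can take the place of [x]. *)
Lemma top_clique_swap Q u x : top_clique Q -> u \in S -> x \in Q -> ~~ e u x ->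
  top_clique (u |: (Q :\ x)).
Proof.
move=> Qt uS xQ nux; have uy := top_clique_uniq Qt uS xQ nux.
have /and3P[QS Qc /eqP Qw] := Qt; apply/and3P; split.
- by rewrite subUset sub1set uS (subset_trans (subD1set _ _)).
- apply: clique_setU1 => // [|y].
    apply/cliqueP => y z /setD1P[_ yQ] /setD1P[_ zQ]; exact: (cliqueP _ _ Qc).
  by rewrite !inE => /andP[yx yQ] _; apply: uy.
(* Were [u] already in [Q :\ x], it would be adjacent to itself. *)
- rewrite cardsU1 -Qw (cardsD1 x Q) xQ; apply/eqP; congr (nat_of_bool _ + _)%N.
  rewrite !inE negb_and negbK; apply/orP; case: (eqVneq u x) => [|ux]; [by left|right].
  by apply/negP => uQ; move: (uy u uQ ux); rewrite e_irr.
Qed.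

(** Swap [v] into a top clique, then [u] for [v]. The nonneighbour of [z] in the last clique is [u]:
    any other would be, besides [v], a second nonneighbour of [z] in the previous clique. Thus
    nonadjacency is an equivalence relation on [S]. *)
Lemma nonadj_trans u v z : u \in S -> v \in S -> z \in S ->
  ~~ e u v -> ~~ e v z -> ~~ e u z.
Proof.
move=> uS vS zS nuv nvz; have [Q0 Q0t] := top_clique_exists.
have [x [xQ nvx] _] := top_clique_nonadj Q0t vS.
have Qt := top_clique_swap Q0t vS xQ nvx; set Q := _ |: _ in Qt.
have vQ : v \in Q by rewrite !inE eqxx.
rewrite e_sym in nvz.
have Q1t := top_clique_swap Qt uS vQ nuv.
have [y [yQ1 nzy] _] := top_clique_nonadj Q1t zS.
move: yQ1; rewrite in_setU1 => /orP[/eqP yu|]; first by rewrite e_sym -yu.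
rewrite in_setD1 => /andP[yv yQ].
by have := top_clique_uniq Qt zS vQ nvz yQ yv; rewrite (negPf nzy).
Qed.

(** The colour of a vertex is the position in a top clique [Q] of its unique nonneighbour. A colour
    class consists of the nonneighbours in [S] of one vertex of [Q], hence its size. *)
Lemma turan_closed_eq : exists c : 'I_n -> 'I_omega,
  {in S &, forall x y, e x y = (c x != c y)} /\
  forall i, #|[set x in S | c x == i]| = (#|S| - d)%N.
Proof.
have [Q Qt] := top_clique_exists; have /and3P[QS Qc /eqP Qw] := Qt.
have w0 : (0 < omega)%N.
  by case/set0Pn: S_neq0 => x _; apply: clique_number_gt0; case: (n) x => // -[].
have Q0 : {q | q \in Q}.
  by apply/sigW/set0Pn; rewrite -card_gt0 Qw.
(* The default keeps [rep u] in [Q] even for a vertex outside [S] that is adjacent to all of [Q]. *)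
pose rep u := odflt (sval Q0) [pick x in Q | ~~ e u x].
have repP u : u \in S -> rep u \in Q /\ ~~ e u (rep u).
  move=> uS; rewrite /rep; case: pickP => [x /andP[xQ nux]|h] //=.
  by have [x [xQ nux] _] := top_clique_nonadj Qt uS; have := h x; rewrite xQ nux.
have repE u x : u \in S -> x \in Q -> (rep u == x) = ~~ e u x.
  move=> uS xQ; have [rQ nur] := repP u uS; apply/eqP/idP => [<- //|nux].
  apply/eqP/negPn/negP => rx.
  by have := top_clique_uniq Qt uS xQ nux rQ rx; rewrite (negPf nur).
have idx u : (index (rep u) (enum Q) < omega)%N.
  rewrite -Qw cardE index_mem mem_enum /rep; case: pickP => [x /andP[]//|_] /=.
  exact: (svalP Q0).
exists (fun u => Ordinal (idx u)); split=> [x y xS yS|i].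
  have [rxQ nxr] := repP x xS; have [ryQ nyr] := repP y yS.
  have -> : (Ordinal (idx x) == Ordinal (idx y)) = (rep x == rep y).
    rewrite -val_eqE /=; apply/eqP/eqP => [|-> //].
    by apply: (index_inj (rep x)); rewrite mem_enum.
  rewrite repE // negbK; apply/idP/idP.
    apply: contraTT => nxr'; rewrite e_sym in nyr.
    exact: (nonadj_trans xS (subsetP QS _ ryQ) yS nxr' nyr).
  by apply: contraTT => nxy; apply: (nonadj_trans xS yS (subsetP QS _ ryQ) nxy nyr).
have [x0 _] := Q0.
pose q := nth x0 (enum Q) i.
have qQ : q \in Q by rewrite -mem_enum mem_nth // -cardE Qw.
have -> : [set x in S | Ordinal (idx x) == i] = S :\: [set w | e q w].
  apply/setP => x; rewrite !inE andbC; case xS: (x \in S); rewrite ?andbF // !andbT.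
  rewrite e_sym -repE // -val_eqE /= /q; apply/eqP/eqP => [<-|->].
    by rewrite nth_index // mem_enum; have [] := repP x xS.
  by rewrite index_uniq ?enum_uniq // -cardE Qw.
rewrite cardsD (setIidPr _) ?e_deg //.
by apply/subsetP => w; rewrite inE => /S_closed; apply; apply: (subsetP QS).
Qed.
End ClosedSet.
End RegularGraph.

(** * Isomorphisms with Turan graphs *)

(** The number of [x] is its rank within its class times [w], plus its colour. Its residue modulo
    [w] is then the colour, as [turan_rel] requires. *)
Lemma part_coordinates (V : finType) (S : {set V}) (w k : nat) (c : V -> 'I_w) :
  (forall i, #|[set x in S | c x == i]| = k) ->
  exists g : V -> nat, [/\ {in S, forall x, (g x < w * k)%N},
    forall x, (g x %% w = c x)%N & {in S &, injective g}].
Proof.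
move=> ck; pose fib x := enum [set y in S | c y == c x].
exists (fun x => (index x (fib x) * w + c x)%N); split=> [x xS|x|x y xS yS].
- have : (index x (fib x) < k)%N.
    by rewrite -(ck (c x)) cardE index_mem mem_enum inE xS eqxx.
  have := ltn_ord (c x); nia.
- by rewrite modnMDl modn_small.
move=> gxy; have cxy : c x = c y.
  apply: val_inj => /=; have := congr1 (modn^~ w) gxy => /=.
  by rewrite !modnMDl !modn_small.
have fxy : fib x = fib y by rewrite /fib cxy.
apply: (@index_inj _ x (fib y)); rewrite ?mem_enum ?inE ?xS ?yS ?cxy ?eqxx //=.
have w0 : (0 < w)%N by apply: leq_ltn_trans (ltn_ord (c x)).
apply/eqP; rewrite -(eqn_pmul2r w0); apply/eqP.
by move/eqP: gxy; rewrite cxy fxy eqn_add2r => /eqP.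
Qed.

Section TuranIsomorphism.
Variables (n : nat) (e : rel 'I_n) (d : nat).
Hypotheses (e_sym : symmetric e) (e_irr : irreflexive e).
Hypothesis e_deg : forall v : 'I_n, #|[set w | e v w]| = d.

Local Notation omega := (clique_number e).

Definition separates (S : {set 'I_n}) :=
  [/\ S != set0, ~: S != set0 & forall x y, e x y -> (x \in S) = (y \in S)].

(** The equality case of [turan_closed_bound], in additive form to avoid truncated subtraction. *)
Definition turan_balanced (S : {set 'I_n}) := (#|S| + omega * d = omega * #|S|)%N.

Lemma separates_closed S : separates S -> forall x y, x \in S -> e x y -> y \in S.
Proof. by case=> _ _ sS x y xS /sS <-. Qed.

Lemma separatesC S : separates S -> separates (~: S).
Proof. by case=> s0 s1 sS; split; rewrite ?setCK // => x y /sS; rewrite !inE => ->. Qed.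

Lemma balanced_turan : (0 < n)%N -> turan_balanced setT ->
  (omega %| n)%N /\ isomorphic e (turan_rel n omega).
Proof.
rewrite /turan_balanced => n0 bT.
have T0 : [set: 'I_n] != set0 by rewrite -card_gt0 cardsT card_ord.
have cl x y : x \in [set: 'I_n] -> e x y -> y \in [set: 'I_n] by rewrite !inE.
have [c [ec ck]] := turan_closed_eq e_sym e_irr e_deg cl T0 bT.
have [g [gn gc gi]] := part_coordinates ck.
move: bT gn; rewrite cardsT card_ord => bT gn.
have nk : (omega * (n - d) = n)%N by rewrite mulnBr -bT addnK.
rewrite nk in gn; split; first by apply/dvdnP; exists (n - d)%N; rewrite mulnC.
exists (fun x => Ordinal (gn x (in_setT x))); split.
  apply: inj_card_bij; last by rewrite leqnn.
  by move=> x y /(congr1 val) /=; apply: gi; rewrite inE.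
by move=> x y; rewrite ec ?inE // /turan_rel /= !gc.
Qed.

Lemma balanced_union S : (0 < d)%N -> separates S ->
  turan_balanced S -> turan_balanced (~: S) ->
  (omega.*2 %| n)%N /\
  isomorphic e (union_rel (turan_rel n./2 omega) (turan_rel n./2 omega)).
Proof.
rewrite /turan_balanced => d0 sepS b1 b2; have [S0 C0 sS] := sepS.
have cl1 := separates_closed sepS; have cl2 := separates_closed (separatesC sepS).
have [c1 [ec1 ck1]] := turan_closed_eq e_sym e_irr e_deg cl1 S0 b1.
have [c2 [ec2 ck2]] := turan_closed_eq e_sym e_irr e_deg cl2 C0 b2.
have [g1 [gn1 gc1 gi1]] := part_coordinates ck1.
have [g2 [gn2 gc2 gi2]] := part_coordinates ck2.
have nS : (#|S| + #|~: S| = n)%N by rewrite cardsC card_ord.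
(* Both sizes solve [omega * d = (omega - 1) * size], and [0 < d] rules out [omega = 1]. *)
have SC : #|~: S| = #|S| by have := card_gt0 S; rewrite S0; nia.
have Sh : #|S| = n./2 by move: nS; rewrite SC; lia.
have nn : (n./2 + n./2 = n)%N by move: nS; rewrite SC Sh.
have k1 : (omega * (#|S| - d) = n./2)%N by rewrite mulnBr -b1 addnK.
rewrite ?SC ?k1 in gn1 gn2; split.
  by apply/dvdnP; exists (#|S| - d)%N; move: k1 nn; rewrite -muln2; lia.
pose f0 x := (if x \in S then g1 x else n./2 + g2 x)%N.
have f0n x : (f0 x < n./2 + n./2)%N.
  rewrite /f0; case xS: (x \in S); first by rewrite ltn_addr // gn1.
  by rewrite ltn_add2l gn2 // inE xS.
exists (fun x => Ordinal (f0n x)); split.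
  apply: inj_card_bij; last by rewrite !card_ord nn.
  move=> x y /(congr1 val) /=; rewrite /f0.
  case xS: (x \in S); case yS: (y \in S) => h.
  - exact: gi1.
  - by have := gn1 _ xS; rewrite h ltnNge leq_addr.
  - by have := gn1 _ yS; rewrite -h ltnNge leq_addr.
  - by apply: gi2; rewrite ?inE ?xS ?yS //; apply/eqP; rewrite -(eqn_add2l n./2) h.
move=> x y; rewrite /union_rel /turan_rel.
have lt1 z : z \in S -> (f0 z < n./2)%N by move=> zS; rewrite /f0 zS gn1.
have ge1 z : z \notin S -> (n./2 <= f0 z)%N by move=> /negPf zS; rewrite /f0 zS leq_addr.
have e0 : (x \in S) != (y \in S) -> e x y = false.
  by move=> xy; apply/negP => /sS xy'; rewrite xy' eqxx in xy.
case: splitP => i /= hi; case: splitP => j /= hj.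
- have xS : x \in S by apply/negPn/negP => /ge1; rewrite hi leqNgt ltn_ord.
  have yS : y \in S by apply/negPn/negP => /ge1; rewrite hj leqNgt ltn_ord.
  by rewrite -hi -hj /f0 xS yS !gc1 ec1.
- have xS : x \in S by apply/negPn/negP => /ge1; rewrite hi leqNgt ltn_ord.
  have yS : y \notin S by apply/negP => /lt1; rewrite hj ltnNge leq_addr.
  by apply: e0; rewrite xS (negPf yS).
- have xS : x \notin S by apply/negP => /lt1; rewrite hi ltnNge leq_addr.
  have yS : y \in S by apply/negPn/negP => /ge1; rewrite hj leqNgt ltn_ord.
  by apply: e0; rewrite yS (negPf xS).
- have xS : x \notin S by apply/negP => /lt1; rewrite hi ltnNge leq_addr.
  have yS : y \notin S by apply/negP => /lt1; rewrite hj ltnNge leq_addr.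
  move: hi hj; rewrite /f0 (negPf xS) (negPf yS).
  move=> /eqP; rewrite eqn_add2l => /eqP <- /eqP; rewrite eqn_add2l => /eqP <-.
  by rewrite !gc2 ec2 ?inE.
Qed.

(** The first [omega] vertices of the Turan graph represent its classes in [multipartite_count]. *)
Lemma turan_iso_balanced : (0 < n)%N -> isomorphic e (turan_rel n omega) ->
  turan_balanced setT.
Proof.
move=> n0 [f [[f' fK f'K] ef]]; have w0 := clique_number_gt0 e n0.
have wn : (omega <= n)%N.
  by apply/bigmax_leqP => Q _; rewrite -[X in (_ <= X)%N]card_ord max_card.
have cl x y : x \in [set: 'I_n] -> e x y -> y \in [set: 'I_n] by rewrite !inE.
pose c u : 'I_omega := Ordinal (ltn_pmod (f u) w0).
apply: (multipartite_count e_deg cl (r := fun j => f' (widen_ord wn j)) (c := c)) => [j|j u _].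
  by rewrite inE.
by rewrite ef f'K /turan_rel /= modn_small // -val_eqE.
Qed.

(** [S] is the preimage of the first half. Each half has at least [omega] vertices, and its first
    [omega] ones represent its classes. *)
Lemma union_iso_balanced : (0 < n)%N -> (omega.*2 %| n)%N ->
  isomorphic e (union_rel (turan_rel n./2 omega) (turan_rel n./2 omega)) ->
  exists S, [/\ separates S, turan_balanced S & turan_balanced (~: S)].
Proof.
move=> n0 wn [f [[f' fK f'K] ef]]; have w0 := clique_number_gt0 e n0.
have wm : (omega <= n./2)%N.
  by have := dvdn_leq n0 wn; rewrite -[X in (_ <= X./2)%N]doubleK; lia.
pose S := [set x | (f x < n./2)%N].
have inl_S j : f' (lshift _ j) \in S by rewrite inE f'K /=.
have inr_S j : f' (rshift _ j) \in ~: S by rewrite !inE f'K /= -leqNgt leq_addr.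
have sep : separates S.
  split; first by apply/set0Pn; exists (f' (lshift _ (Ordinal (leq_trans w0 wm)))).
    by apply/set0Pn; exists (f' (rshift _ (Ordinal (leq_trans w0 wm)))).
  move=> x y; rewrite ef /union_rel !inE.
  by case: splitP => i hi; case: splitP => j hj // _; rewrite hi hj /= ?ltn_ord // !ltnNge !leq_addr.
exists S; split=> //.
- pose c u : 'I_omega := Ordinal (ltn_pmod (f u) w0).
  apply: (multipartite_count e_deg (separates_closed sep)
    (r := fun j => f' (lshift _ (widen_ord wm j))) (c := c)) => // j u.
  rewrite inE ef f'K /union_rel => uS.
  case: splitP => i /= hi; last by have := ltn_ord j; move: wm; rewrite hi; lia.
  case: splitP => k /= hk; last by move: uS; rewrite hk ltnNge leq_addr.
  by rewrite /turan_rel -hi -hk modn_small // -val_eqE.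
- pose c u : 'I_omega := Ordinal (ltn_pmod (f u - n./2) w0).
  apply: (multipartite_count e_deg (separates_closed (separatesC sep))
    (r := fun j => f' (rshift _ (widen_ord wm j))) (c := c)) => // j u.
  rewrite !inE ef f'K /union_rel -leqNgt => uS.
  case: splitP => i /= hi; first by have := ltn_ord i; rewrite -hi ltnNge leq_addr.
  case: splitP => k /= hk; first by move: uS; rewrite hk leqNgt ltn_ord.
  move/eqP: hi; rewrite eqn_add2l => /eqP hi.
  by rewrite /turan_rel -hi modn_small // -val_eqE /= hk addKn.
Qed.
End TuranIsomorphism.

(** * Spectrum of a regular graph and test vectors for the second eigenvalue *)

Section Spectrum.
Variables (R : rcfType) (n : nat) (e : rel 'I_n) (d : nat).
Hypotheses (e_sym : symmetric e) (e_irr : irreflexive e).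
Hypothesis e_deg : forall v : 'I_n, #|[set w | e v w]| = d.

Local Notation omega := (clique_number e).
Local Notation a i j := ((e i j)%:R : R).

Lemma row_degree i : \sum_j a i j = d%:R.
Proof.
rewrite -(e_deg i) -natr_sum -sum1_card [in RHS]big_mkcond; congr (_%:R).
by apply: eq_bigr => j _; rewrite inE; case: (e i j).
Qed.

(** The energy of the Laplacian [d - A], each edge counted in both directions. It vanishes for
    functions constant along edges. *)
Lemma laplacian_form (x : 'I_n -> R) :
  \sum_i \sum_j a i j * (x i - x j) ^+ 2 =
  2 * (d%:R * (\sum_i x i ^+ 2) - \sum_i \sum_j a i j * x i * x j).
Proof.
have E1 : \sum_i \sum_j a i j * x i ^+ 2 = d%:R * (\sum_i x i ^+ 2).
  by rewrite mulr_sumr; apply: eq_bigr => i _; rewrite -mulr_suml row_degree.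
have E2 : \sum_i \sum_j a i j * x j ^+ 2 = d%:R * (\sum_i x i ^+ 2).
  rewrite exchange_big -E1; apply: eq_bigr => i _; apply: eq_bigr => j _.
  by rewrite e_sym.
have -> : \sum_i \sum_j a i j * (x i - x j) ^+ 2 =
   (\sum_i \sum_j a i j * x i ^+ 2) + (\sum_i \sum_j a i j * x j ^+ 2)
   - 2 * (\sum_i \sum_j a i j * x i * x j).
  rewrite mulr_sumr -sumrN -!big_split; apply: eq_bigr => i _ /=.
  rewrite mulr_sumr -sumrN -!big_split; apply: eq_bigr => j _ /=; ring.
by rewrite E1 E2; ring.
Qed.

Lemma form_le_degree (x : 'I_n -> R) :
  \sum_i \sum_j a i j * x i * x j <= d%:R * (\sum_i x i ^+ 2).
Proof.
have : 0 <= \sum_i \sum_j a i j * (x i - x j) ^+ 2.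
  by apply: sumr_ge0 => i _; apply: sumr_ge0 => j _; rewrite mulr_ge0 ?sqr_ge0.
by rewrite laplacian_form; lra.
Qed.

Lemma mulmx_adj (x : 'rV[R]_n) i : (x *m adjmx R e) 0 i = \sum_j a i j * x 0 j.
Proof. by rewrite mxE; apply: eq_bigr => j _; rewrite mxE mulrC e_sym. Qed.

Lemma dotv_adj (x : 'rV[R]_n) :
  dotv (x *m adjmx R e) x = \sum_i \sum_j a i j * x 0 i * x 0 j.
Proof.
rewrite dotvE; apply: eq_bigr => i _; rewrite mulmx_adj mulr_suml.
by apply: eq_bigr => j _; ring.
Qed.

Lemma dotv_sqr (x : 'rV[R]_n) : dotv x x = \sum_i x 0 i ^+ 2.
Proof. by rewrite dotvE; apply: eq_bigr => i _; rewrite expr2. Qed.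

(** The constant vector has eigenvalue [d], which is the largest by [form_le_degree]. Applying
    [second_eigen] to it turns orthogonality into the condition of sum zero. *)
Lemma regular_spectrum (s : seq R) : (1 < n)%N ->
  char_poly (adjmx R e) = \prod_(x <- s) ('X - x%:P) ->
  sorted (fun x y : R => y <= x) s ->
  [/\ s`_0 = d%:R, s`_1 <= d%:R,
    forall x : 'I_n -> R, \sum_i x i = 0 ->
      \sum_i \sum_j a i j * x i * x j <= s`_1 * (\sum_i x i ^+ 2) &
    exists v : 'I_n -> R, [/\ exists i, v i != 0, \sum_i v i = 0 &
      forall i, \sum_j a i j * v j = s`_1 * v i]].
Proof.
move=> n1 pA ss.
have szs : size s = n.
  by apply: succn_inj; rewrite -(size_prod_XsubC s id) /= -pA size_char_poly.
have {szs} : (1 < size s)%N by rewrite szs.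
case: s pA ss => [|a0 [|lam s]] // pA ss _ /=.
have rtrans : transitive (fun x y : R => y <= x) by move=> x y z yx xz; apply: le_trans yx.
have min0 := order_path_min rtrans ss.
have /= min1 : all (fun y => y <= lam) s by apply: (order_path_min rtrans); case/andP: ss.
have sA : (adjmx R e)^T = adjmx R e by apply/matrixP => i j; rewrite !mxE e_sym.
pose u : 'rV[R]_n := const_mx 1.
have u0 : u != 0.
  case: (n) n1 @u => // n' _; apply/eqP => /rowP/(_ 0)/eqP; rewrite !mxE.
  by rewrite oner_eq0.
have uA : u *m adjmx R e = d%:R *: u.
  apply/rowP => i; rewrite mulmx_adj !mxE mulr1 -(row_degree i).
  by apply: eq_bigr => j _; rewrite mxE mulr1.
have dle : d%:R <= a0.
  have : root (char_poly (adjmx R e)) d%:R.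
    by rewrite -eigenvalue_root_char; apply/eigenvalueP; exists u.
  rewrite pA root_prod_XsubC inE => /orP[/eqP-> //|].
  by move/(allP min0).
have a0d : a0 = d%:R.
  apply/eqP; rewrite eq_le dle andbT.
  have /eigenvalueP[x xA x0] : eigenvalue (adjmx R e) a0.
    by rewrite eigenvalue_root_char pA root_prod_XsubC inE eqxx.
  have xx : 0 < dotv x x by rewrite lt_def dotvv_eq0 x0 dotvv_ge0.
  rewrite -(ler_pM2r xx) [X in _ <= _ * X]dotv_sqr; apply: le_trans (form_le_degree _).
  by rewrite -dotv_adj xA {2}/dotv -scalemxAl [X in _ <= X]mxE.
rewrite a0d in pA min0 *.
have [ray eig] := second_eigen sA u0 uA pA.
have dotu (x : 'rV[R]_n) : dotv x u = \sum_i x 0 i.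
  by rewrite dotvE; apply: eq_bigr => i _; rewrite mxE mulr1.
split=> //; first by case/andP: min0.
  move=> x x0; pose X : 'rV[R]_n := \row_i x i.
  have XE k : X 0 k = x k by rewrite mxE.
  have Xu : dotv X u = 0 by rewrite dotu -[RHS]x0; apply: eq_bigr => i _.
  have lam_max : all (<= lam) (lam :: s) by rewrite /= lexx.
  have := ray lam lam_max X Xu; rewrite dotv_adj dotv_sqr.
  have -> : \sum_i X 0 i ^+ 2 = \sum_i x i ^+ 2 by apply: eq_bigr => i _; rewrite XE.
  have -> // : \sum_i \sum_j a i j * X 0 i * X 0 j = \sum_i \sum_j a i j * x i * x j.
  by apply: eq_bigr => i _; apply: eq_bigr => j _; rewrite !XE.
have [|v [v0 vA vu]] := eig lam; first by rewrite inE eqxx.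
exists (v 0); split.
- by case/rV0Pn: v0 => i vi; exists i.
- by rewrite -dotu.
- by move=> i; rewrite -mulmx_adj vA mxE.
Qed.

(** The negated inequality and [motzkin_straus] give [w_bound] for the kernel [a i j / d] and
    [rho = lam / d], so [kernel_spectral_gap] would force [v] to vanish. *)
Lemma spectral_gap_strict (lam : R) (v : 'I_n -> R) :
  0 < lam < d%:R -> (exists i, v i != 0) -> \sum_i v i = 0 ->
  (forall i, \sum_j a i j * v j = lam * v i) ->
  omega%:R * (d%:R ^+ 2 + lam ^+ 2) < (omega%:R - 1) * (n%:R * d%:R).
Proof.
move=> /andP[l0 ld] [i0 vi0] v_sum v_eig; rewrite ltNge; apply/negP => hle.
have d0 : 0 < d%:R :> R := lt_trans l0 ld.
have w0 : 0 < omega%:R :> R.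
  by rewrite ltr0n clique_number_gt0 //; case: (n) i0 {vi0} => // -[].
pose rho := lam / d%:R.
have lE : lam = rho * d%:R by rewrite /rho divfK // gt_eqF.
have K := @kernel_spectral_gap R 'I_n (fun i j => a i j / d%:R) rho.
suff : v i0 = 0 by move/eqP; rewrite (negPf vi0).
apply: K => //.
- by move=> i j; rewrite divr_ge0 // ltW.
- by move=> i j; rewrite e_sym.
- by move=> i; rewrite -mulr_suml row_degree divff // gt_eqF.
- by rewrite /rho divr_gt0 //= ltr_pdivrMr // mul1r.
- move=> f f0; rewrite card_ord.
  have := motzkin_straus e_sym e_irr f0.
  set F := \sum_i f i * _ => MS.
  have -> : \sum_i \sum_j a i j / d%:R * f i * f j = F / d%:R.
    rewrite mulr_suml; apply: eq_bigr => i _; rewrite mulr_sumr mulr_suml.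
    by apply: eq_bigr => j _; ring.
  rewrite mulrA ler_pdivrMr //.
  have P0 : 0 <= (\sum_i f i) ^+ 2 by apply: sqr_ge0.
  rewrite -(ler_pM2l (mulr_gt0 w0 d0)).
  have n0 : 0 <= n%:R * d%:R :> R by rewrite mulr_ge0.
  have := ler_wpM2l n0 MS; have := ler_wpM2r P0 hle; rewrite lE; lra.
- move=> i; have := v_eig i; rewrite lE => h.
  transitivity (d%:R^-1 * \sum_j a i j * v j).
    by rewrite mulr_sumr; apply: eq_bigr => j _; ring.
  by rewrite h; field; rewrite gt_eqF.
Qed.

Lemma formE (x : 'I_n -> R) :
  \sum_i \sum_j a i j * x i * x j = \sum_i x i * \sum_j a i j * x j.
Proof.
by apply: eq_bigr => i _; rewrite mulr_sumr; apply: eq_bigr => j _; ring.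
Qed.

(** An eigenvector for [d] has zero Laplacian energy, so it is constant along edges; being nonzero
    with sum zero, it takes both signs. *)
Lemma eigen_degree_separates (v : 'I_n -> R) :
  (exists i, v i != 0) -> \sum_i v i = 0 ->
  (forall i, \sum_j a i j * v j = d%:R * v i) -> separates e [set i | 0 < v i].
Proof.
move=> [i0 vi0] v_sum v_eig.
have adj_eq i j : e i j -> v i = v j.
  move=> eij; have := laplacian_form v; rewrite formE.
  have -> : \sum_i v i * (\sum_j a i j * v j) = d%:R * (\sum_i v i ^+ 2).
    by rewrite mulr_sumr; apply: eq_bigr => k _; rewrite v_eig; ring.
  rewrite subrr mulr0 => L.
  have term0 k l : 0 <= a k l * (v k - v l) ^+ 2 by rewrite mulr_ge0 ?sqr_ge0.
  have Li : \sum_l a i l * (v i - v l) ^+ 2 = 0.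
    by apply: (psumr_eq0P _ L) => // k _; apply: sumr_ge0 => l _.
  have : a i j * (v i - v j) ^+ 2 = 0 by apply: (psumr_eq0P _ Li).
  by rewrite eij mul1r => /eqP; rewrite sqrf_eq0 subr_eq0 => /eqP.
split; last by move=> x y /adj_eq vxy; rewrite !inE vxy.
- apply/set0Pn; apply/existsP; apply: contraNT vi0 => /existsPn np.
  have nv i : 0 <= - v i by have := np i; rewrite inE -leNgt oppr_ge0.
  have /psumr_eq0P vz : \sum_i - v i = 0 by rewrite sumrN v_sum oppr0.
  by rewrite -oppr_eq0 vz.
- apply/set0Pn; apply/existsP; apply: contraNT vi0 => /existsPn np.
  have pv i : 0 <= v i by have := np i; rewrite !inE negbK => /ltW.
  by move/psumr_eq0P: v_sum => -> //.
Qed.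

(** The test vector is constant on each side, so its Laplacian energy is zero; the two values are
    weighted to give sum zero. *)
Lemma separates_degree_le (S : {set 'I_n}) (lam : R) : separates e S ->
  (forall x : 'I_n -> R, \sum_i x i = 0 ->
     \sum_i \sum_j a i j * x i * x j <= lam * (\sum_i x i ^+ 2)) ->
  d%:R <= lam.
Proof.
move=> [S0 C0 sS] ray.
pose x i : R := if i \in S then #|~: S|%:R else - #|S|%:R.
have x_sum : \sum_i x i = 0.
  rewrite (bigID (mem S)) /= (eq_bigr (fun=> #|~: S|%:R)); last by move=> i; rewrite /x => ->.
  rewrite [X in _ + X](eq_bigr (fun=> - #|S|%:R)); last by move=> i; rewrite /x => /negPf ->.
  rewrite sumr_const (eq_bigl (mem (~: S))) ?sumr_const; last by move=> i; rewrite /= inE.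
  by rewrite mulNrn -!mulrnA mulnC subrr.
have Sp : 0 < #|S|%:R :> R by rewrite ltr0n card_gt0.
have xx : 0 < \sum_i x i ^+ 2.
  have /set0Pn[i iC] := C0; rewrite (bigD1 i) //= ltr_wpDr //.
    by apply: sumr_ge0 => j _; apply: sqr_ge0.
  by move: iC; rewrite inE /x => /negPf ->; rewrite sqrrN exprn_gt0.
rewrite -(ler_pM2r xx); apply: le_trans (ray x x_sum).
have := laplacian_form x; rewrite big1; first lra.
move=> i _; rewrite big1 // => j _; case eij: (e i j); last by rewrite mul0r.
by rewrite /x (sS _ _ eij) subrr expr0n mulr0.
Qed.

(** The difference of the indicators of two nonadjacent vertices has sum zero and form zero. *)
Lemma nonadj_second_ge0 (x y : 'I_n) (lam : R) : x != y -> ~~ e x y ->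
  (forall z : 'I_n -> R, \sum_i z i = 0 ->
     \sum_i \sum_j a i j * z i * z j <= lam * (\sum_i z i ^+ 2)) ->
  0 <= lam.
Proof.
move=> xy nxy ray.
(* Written as a shift of the zero function to fit [form_shift]. *)
pose z i : R := 0 + 1 * ((i == x)%:R - (i == y)%:R).
have d1 k : \sum_(i < n) ((i == k)%:R : R) = 1.
  by rewrite -[RHS](sum_delta k (fun=> 1)); apply: eq_bigr => i _; rewrite mulr1.
have z_sum : \sum_i z i = 0.
  rewrite (eq_bigr (fun i => (i == x)%:R - (i == y)%:R)).
    by rewrite sumrB !d1 subrr.
  by move=> i _; rewrite /z add0r mul1r.
have adj0 k : \sum_j a k j * 0 = 0 by rewrite big1 // => j _; rewrite mulr0.
have := ray z z_sum; rewrite formE (form_shift e_sym e_irr (fun=> 0)) //.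
rewrite !adj0 subrr mulr0 addr0 [X in X <= _]big1; last by move=> i _; rewrite mul0r.
rewrite pmulr_lge0 // (bigD1 x) //= ltr_wpDr //.
  by apply: sumr_ge0 => j _; apply: sqr_ge0.
by rewrite /z eqxx (negPf xy) subr0 mulr1 add0r expr1n.
Qed.
End Spectrum.

(** * Assembly of the bound and of the equality cases *)

Lemma clique_number_deg0 (n : nat) (e : rel 'I_n) :
  (forall v : 'I_n, #|[set w | e v w]| = 0%N) -> (clique_number e <= 1)%N.
Proof.
move=> deg0; apply/bigmax_leqP => Q /cliqueP Qc; rewrite leqNgt.
apply/negP => /card_gt1P[x [y [xQ yQ xy]]].
have /eqP := deg0 x; rewrite cards_eq0 => /eqP/setP/(_ y).
by rewrite !inE Qc.
Qed.

(* s is the list of eigenvalues of A_G counted with multiplicity (the roots of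
   the characteristic polynomial), sorted in nonincreasing order; so
   mu1 = s`_0 and mu2 = s`_1. *)
Theorem theorem1p2 (R : realType) (n : nat) (e : rel 'I_n) (s : seq R) :
  simple_graph e -> regular e ->
  ~ isomorphic e (complete_rel (clique_number e)) ->
  char_poly (adjmx R e) = \prod_(x <- s) ('X - x%:P) ->
  sorted (fun x y : R => y <= x) s ->
  let omega := clique_number e in
  let m := num_edges e in
  (s`_0 ^+ 2 + s`_1 ^+ 2 <= 2%:R * (omega%:R - 1) / omega%:R * m%:R) /\
  (s`_0 ^+ 2 + s`_1 ^+ 2 = 2%:R * (omega%:R - 1) / omega%:R * m%:R <->
     ((omega %| n)%N /\ isomorphic e (turan_rel n omega))
     \/ ((omega.*2 %| n)%N /\
         isomorphic e (union_rel (turan_rel n./2 omega) (turan_rel n./2 omega)))).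
Proof.
move=> [e_sym e_irr] [d e_deg] ncomp pA ss omega m.
have [x [y [xy nxy]]] : exists x y, x != y /\ ~~ e x y.
  have [/existsP[x /existsP[y /andP[xy nxy]]]|h] :=
    boolP [exists x, exists y, (x != y) && ~~ e x y]; first by exists x, y.
  case: ncomp; apply: complete_isomorphic => // x y xy.
  apply/negPn/negP => nxy; move/negP: h; apply.
  by apply/existsP; exists x; apply/existsP; exists y; rewrite xy.
have n1 : (1 < n)%N.
  rewrite ltnNge; apply/negP => n1; case/negP: xy; rewrite -val_eqE /=.
  by have := ltn_ord x; have := ltn_ord y; lia.
have n0 : (0 < n)%N := ltnW n1.
have [s0 s1d ray [v [v0 v_sum v_eig]]] := regular_spectrum e_sym e_deg n1 pA ss.
rewrite s0; move: (s`_1) s1d ray v_eig => lam s1d ray v_eig {s0 pA ss s}.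
have lam0 := nonadj_second_ge0 e_sym e_irr xy nxy ray.
have w0 : 0 < omega%:R :> R by rewrite ltr0n clique_number_gt0.
have -> : 2%:R * (omega%:R - 1) / omega%:R * m%:R =
    (omega%:R - 1) * (n%:R * d%:R) / omega%:R :> R.
  by rewrite -natrM -(handshake e_sym e_irr e_deg) natrM -/m; field; rewrite gt_eqF.
pose sharp := omega%:R * (d%:R ^+ 2 + lam ^+ 2) == (omega%:R - 1) * (n%:R * d%:R) :> R.
have balR (S : {set 'I_n}) : turan_balanced e d S ->
    #|S|%:R + omega%:R * d%:R = omega%:R * #|S|%:R :> R.
  by move=> b; rewrite -!natrM -natrD b.
have bound (S : {set 'I_n}) : S != set0 -> (forall x y, x \in S -> e x y -> y \in S) ->
    #|S|%:R + omega%:R * d%:R <= omega%:R * #|S|%:R :> R.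
  move=> S0 Scl; rewrite -!natrM -natrD ler_nat.
  exact: (turan_closed_bound e_sym e_irr e_deg Scl S0).
have boundE (S : {set 'I_n}) : #|S|%:R + omega%:R * d%:R = omega%:R * #|S|%:R :> R ->
    turan_balanced e d S.
  by move=> /eqP; rewrite -!natrM -natrD eqr_nat => /eqP.
have dd0 : 0 <= d%:R :> R by rewrite ler0n.
have cT : #|[set: 'I_n]| = n by rewrite cardsT card_ord.
have [le sharp_struct] : omega%:R * (d%:R ^+ 2 + lam ^+ 2) <= (omega%:R - 1) * (n%:R * d%:R) :> R
    /\ (sharp -> turan_balanced e d setT \/
        [/\ (0 < d)%N & exists S, [/\ separates e S, turan_balanced e d S & turan_balanced e d (~: S)]]).
  have [l0|l0] := eqVneq lam 0.
    have T0 : [set: 'I_n] != set0 by rewrite -card_gt0 cT.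
    have B := bound setT T0 (fun _ y _ _ => in_setT y); rewrite cT in B.
    have B' := ler_wpM2r dd0 B; rewrite l0; split; first by lra.
    rewrite /sharp l0 => /eqP sh; left; apply: boundE; rewrite cT.
    (* With [d = 0] the factor [d] cannot be cancelled from [sh]; then [omega = 1], and balance is
       immediate. *)
    have [dz|dz] := eqVneq d 0%N.
      have : (omega <= 1)%N by apply: clique_number_deg0 => u; rewrite e_deg.
      have : (0 < omega)%N by rewrite clique_number_gt0.
      rewrite dz mulr0 addr0; case: (omega) => [|[|]] // _ _; by rewrite mul1r.
    have dn : d%:R != 0 :> R by rewrite pnatr_eq0.
    by apply: (mulIf dn); lra.
  have lp : 0 < lam by rewrite lt_def l0.
  have [ld|ld] := eqVneq lam d%:R; last first.
    have lt : lam < d%:R by rewrite lt_def eq_sym ld.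
    have st := spectral_gap_strict e_sym e_irr e_deg (lam := lam) (v := v).
    have {}st := st _ v0 v_sum v_eig; rewrite lp lt in st; have {}st := st isT.
    by split; [exact: ltW|rewrite /sharp lt_eqF].
  rewrite ld in v_eig lp *.
  have sep := eigen_degree_separates e_sym e_deg v0 v_sum v_eig.
  set S := [set i | _] in sep.
  have B1 := bound S (let: And3 h _ _ := sep in h) (separates_closed sep).
  have B2 := bound (~: S) (let: And3 _ h _ := sep in h) (separates_closed (separatesC sep)).
  have nS : n%:R = #|S|%:R + #|~: S|%:R :> R by rewrite -natrD cardsC card_ord.
  have B1' := ler_wpM2r dd0 B1; have B2' := ler_wpM2r dd0 B2.
  split; first by rewrite nS; lra.
  rewrite /sharp ld => /eqP sh; right; split; first by rewrite -(ltr0n R).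
  (* The bounds [B1] and [B2], multiplied by [d], add up to the equality [sh], so both are
     equalities. *)
  rewrite nS in sh; exists S; split=> //; apply: boundE; apply/eqP;
    by rewrite eq_le (B1, B2) /= -(ler_pM2r lp); lra.
split; first by rewrite ler_pdivlMr // mulrC.
have -> : (d%:R ^+ 2 + lam ^+ 2 = (omega%:R - 1) * (n%:R * d%:R) / omega%:R) <-> sharp.
  rewrite /sharp; split=> [->|/eqP <-]; first by rewrite mulrC divfK // gt_eqF.
  by rewrite mulrC mulKf // gt_eqF.
split=> [/sharp_struct[b|[d0 [S [sep b1 b2]]]]|].
- by left; apply: (balanced_turan e_sym e_irr e_deg).
- by right; apply: (balanced_union e_sym e_irr e_deg d0 sep).
rewrite /sharp eq_le le /=; case=> [[_ iso]|[wn iso]].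
  (* Balance means [omega * d = (omega - 1) * n], so the square of [d] alone reaches the bound. *)
  have /balR := turan_iso_balanced e_deg n0 iso; rewrite cT => b.
  have b' := congr1 ( *%R^~ d%:R) b; have := sqr_ge0 lam; rewrite -(pmulr_rge0 _ w0) /= in b' *; lra.
have [S [sep /balR b1 /balR b2]] := union_iso_balanced e_deg n0 wn iso.
have nS : n%:R = #|S|%:R + #|~: S|%:R :> R by rewrite -natrD cardsC card_ord.
(* Separation gives [d <= lam], so the left side is at least [2 * omega * d ^+ 2], which the two
   balance equations times [d] identify with the bound. *)
have dl := separates_degree_le e_sym e_deg sep ray.
have : omega%:R * d%:R ^+ 2 <= omega%:R * lam ^+ 2 by rewrite ler_pM2l // ler_sqr ?nnegrE.
have b1' := congr1 ( *%R^~ d%:R) b1; have b2' := congr1 ( *%R^~ d%:R) b2.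
rewrite /= in b1' b2'; rewrite nS; lra.
Qed.
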